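(* The following is provable in ${\sf RCA}_0$: if $G=(V,E)$ is a countable graph and there is a finite set $V_0=\{v_0,v_1,\dots,v_{n-1}\}$ of vertices of $G$ such that each vertex of $G$ is either in $V_0$ or path connected to at least one element of $V_0$, then $G$ can be decomposed into its connected components (that is, there is a function $f\colon V\to\mathbb{N}$ such that for all distinct vertices $v_1,v_2$, $f(v_1)=f(v_2)$ if and only if $v_1$ is path connected to $v_2$), and consequently $G$ has a connected component.
   Context: ${\sf RCA}_0$ is the subsystem of second order arithmetic with basic axioms, $\Delta^0_1$ comprehension and $\Sigma^0_1$ induction. In ${\sf RCA}_0$, a countable graph is a pair $(V,E)$ with $V$ a nonempty infinite subset of $\mathbb{N}$ and $E$ a set of unordered pairs of elements of $V$. A connected component of $G$ is a set $C\subseteq V$ such that any two elements of $C$ are joined by a finite path in $G$, and whenever $x\in C$ and there is a path from $x$ to $y\in V$, then $y\in C$. *)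

(* Defs.v *)
From Stdlib Require Import List.
Import ListNotations.

(** * The language of second order arithmetic

    Variables are de Bruijn indices, with independent index spaces for number
    variables and set variables: [AllN] binds number index 0 and [AllS] binds
    set index 0.  Equality is primitive for numbers only.  As the logic is
    classical, implication, falsity and the universal quantifiers suffice as
    primitives. *)

Inductive term : Type :=
| Var (n : nat)
| Zero
| One
| Add (s t : term)
| Mul (s t : term).

Inductive form : Type :=
| Eq (s t : term)
| Lt (s t : term)
| Mem (t : term) (X : nat)
| Bot
| Imp (p q : form)
| AllN (p : form)
| AllS (p : form).

Declare Scope so_scope.
Delimit Scope so_scope with so.
Bind Scope so_scope with term form.
Open Scope so_scope.

Notation "# n" := (Var n) (at level 1, n at level 0, format "# n") : so_scope.
Infix "+" := Add : so_scope.
Infix "*" := Mul : so_scope.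
Infix "==" := Eq (at level 70, no associativity) : so_scope.
Infix "<" := Lt : so_scope.
Infix "∈" := Mem (at level 70, no associativity) : so_scope.
Infix "⇒" := Imp (at level 90, right associativity) : so_scope.

Definition Not (p : form) : form := p ⇒ Bot.
Definition And (p q : form) : form := Not (p ⇒ Not q).
Definition Or (p q : form) : form := Not p ⇒ q.
Definition Iff (p q : form) : form := And (p ⇒ q) (q ⇒ p).
Definition ExN (p : form) : form := Not (AllN (Not p)).
Definition ExS (p : form) : form := Not (AllS (Not p)).

Infix "∧" := And (at level 80, right associativity) : so_scope.
Infix "∨" := Or (at level 85, right associativity) : so_scope.
Infix "⇔" := Iff (at level 95, no associativity) : so_scope.

(** Simultaneous substitution of terms for number variables and renaming of
    set variables. *)

Fixpoint tsubst (f : nat -> term) (t : term) : term :=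
  match t with
  | Var n => f n
  | Zero => Zero
  | One => One
  | Add s t => Add (tsubst f s) (tsubst f t)
  | Mul s t => Mul (tsubst f s) (tsubst f t)
  end.

Definition lift (k : nat) : term -> term := tsubst (fun n => Var (k + n)%nat).

Definition upN (f : nat -> term) (n : nat) : term :=
  match n with 0 => #0 | S n => lift 1 (f n) end.

Definition upS (r : nat -> nat) (n : nat) : nat :=
  match n with 0 => 0 | S n => S (r n) end.

Fixpoint subst (f : nat -> term) (r : nat -> nat) (p : form) : form :=
  match p with
  | Eq s t => Eq (tsubst f s) (tsubst f t)
  | Lt s t => Lt (tsubst f s) (tsubst f t)
  | Mem t X => Mem (tsubst f t) (r X)
  | Bot => Bot
  | Imp p q => Imp (subst f r p) (subst f r q)
  | AllN p => AllN (subst (upN f) r p)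
  | AllS p => AllS (subst f (upS r) p)
  end.

Definition liftN : form -> form := subst (fun n => Var (S n)) (fun X => X).
Definition liftS : form -> form := subst Var S.

Definition instN (t : term) : form -> form :=
  subst (fun n => match n with 0 => t | S n => #n end) (fun X => X).
Definition instS (Y : nat) : form -> form :=
  subst Var (fun X => match X with 0 => Y | S X => X end).

(** * Classical two-sorted natural deduction with equality

    The nonlogical axioms [T] may have free variables and then stand for their
    universal closures: the eigenvariable conditions of the introduction rules
    for the quantifiers concern the context only. *)

Inductive proves (T : form -> Prop) : list form -> form -> Prop :=
| pAx G p : T p -> proves T G p
| pHyp G p : In p G -> proves T G p
| pImpI G p q : proves T (p :: G) q -> proves T G (p ⇒ q)
| pImpE G p q : proves T G (p ⇒ q) -> proves T G p -> proves T G q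
| pRaa G p : proves T (Not p :: G) Bot -> proves T G p
| pAllNI G p : proves T (map liftN G) p -> proves T G (AllN p)
| pAllNE G p t : proves T G (AllN p) -> proves T G (instN t p)
| pAllSI G p : proves T (map liftS G) p -> proves T G (AllS p)
| pAllSE G p Y : proves T G (AllS p) -> proves T G (instS Y p)
| pEqRefl G t : proves T G (t == t)
| pEqSubst G p s t :
    proves T G (s == t) -> proves T G (instN s p) -> proves T G (instN t p).

Definition provable (T : form -> Prop) (p : form) : Prop := proves T [] p.

(** * The axioms of RCA_0 *)

(** In bounded quantifiers the bound does not contain the bound variable. *)
Definition AllB (t : term) (p : form) : form := AllN (#0 < lift 1 t ⇒ p).
Definition ExB (t : term) (p : form) : form := ExN (#0 < lift 1 t ∧ p).

Inductive Delta00 : form -> Prop :=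
| dEq s t : Delta00 (s == t)
| dLt s t : Delta00 (s < t)
| dMem t X : Delta00 (t ∈ X)
| dBot : Delta00 Bot
| dImp p q : Delta00 p -> Delta00 q -> Delta00 (p ⇒ q)
| dAllB t p : Delta00 p -> Delta00 (AllB t p)
| dExB t p : Delta00 p -> Delta00 (ExB t p).

Inductive Sigma01 : form -> Prop :=
| Sigma01_intro p : Delta00 p -> Sigma01 (ExN p).

Inductive Pi01 : form -> Prop :=
| Pi01_intro p : Delta00 p -> Pi01 (AllN p).

Inductive basic_axiom : form -> Prop :=
| ax_succ_ne0 : basic_axiom (Not (#0 + One == Zero))
| ax_succ_inj : basic_axiom (#0 + One == #1 + One ⇒ #0 == #1)
| ax_add0 : basic_axiom (#0 + Zero == #0)
| ax_addS : basic_axiom (#0 + (#1 + One) == (#0 + #1) + One)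
| ax_mul0 : basic_axiom (#0 * Zero == Zero)
| ax_mulS : basic_axiom (#0 * (#1 + One) == (#0 * #1) + #0)
| ax_lt0 : basic_axiom (Not (#0 < Zero))
| ax_ltS : basic_axiom (#0 < #1 + One ⇔ (#0 < #1 ∨ #0 == #1)).

(** [p] with its distinguished variable, number index 0, replaced by its
    successor. *)
Definition at_succ (p : form) : form :=
  subst (fun n => match n with 0 => #0 + One | S n => #(S n) end)
        (fun X => X) p.

Definition induction_axiom (p : form) : form :=
  (instN Zero p ∧ AllN (p ⇒ at_succ p)) ⇒ AllN p.

(** The lift keeps the new set from occurring in the comprehension formula. *)
Definition comprehension_axiom (p q : form) : form :=
  AllN (p ⇔ q) ⇒ ExS (AllN (#0 ∈ 0 ⇔ liftS p)).

Inductive RCA0 : form -> Prop :=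
| rca_basic p : basic_axiom p -> RCA0 p
| rca_induction p : Sigma01 p -> RCA0 (induction_axiom p)
| rca_comprehension p q :
    Sigma01 p -> Pi01 q -> RCA0 (comprehension_axiom p q).

(** * Graphs in second order arithmetic *)

Definition Le (s t : term) : form := s < t ∨ s == t.
Infix "≤" := Le (at level 70, no associativity) : so_scope.

(** The usual pairing in RCA_0: (i,j) = (i+j)^2 + i. *)
Definition pair (s t : term) : term := (s + t) * (s + t) + s.

Definition Subset (X Y : nat) : form := AllN (#0 ∈ X ⇒ #0 ∈ Y).

Definition FiniteSet (X : nat) : form := ExN (AllN (#0 ∈ X ⇒ #0 < #1)).

(** [V] is nonempty and infinite, and every element of [E] is an unordered pair
    {x,y} of elements of [V], represented by the code (x,y) with x ≤ y. *)
Definition Graph (V E : nat) : form :=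
  ExN (#0 ∈ V)
  ∧ AllN (ExN (#0 ∈ V ∧ #1 < #0))
  ∧ AllN (#0 ∈ E ⇒
      ExN (ExN (#1 ∈ V ∧ #0 ∈ V ∧ #1 ≤ #0 ∧ #2 == pair #1 #0))).

Definition Adj (E : nat) (s t : term) : form :=
  (s ≤ t ∧ pair s t ∈ E) ∨ (t ≤ s ∧ pair t s ∈ E).

(** Goedel's beta function, which codes finite sequences by numbers: the [i]-th
    entry of the sequence coded by [a] and [b] is the remainder of [a] modulo
    (i+1)b+1.  The formula says that this entry is [z]. *)
Definition Entry (a b i z : term) : form :=
  let m := (i + One) * b + One in
  z < m ∧ ExB (a + One) (lift 1 a == #0 * lift 1 m + lift 1 z).

(** There is a finite sequence (coded by [a], [b]) of length [l]+1 that starts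
    at [s], ends at [t] and whose consecutive entries are adjacent.  Length 1 is
    allowed, so every vertex is path connected to itself. *)
Definition Path (E : nat) (s t : term) : form :=
  (* a = #2, b = #1, l = #0 *)
  ExN (ExN (ExN (
    Entry #2 #1 Zero (lift 3 s)
    ∧ Entry #2 #1 #0 (lift 3 t)
    ∧ AllB #0 (ExB (#3 + One) (ExB (#4 + One) (
        (* a = #5, b = #4, i = #2, i-th entry = #1, (i+1)-st entry = #0 *)
        Entry #5 #4 #2 #1 ∧ Entry #5 #4 (#2 + One) #0 ∧ Adj E #1 #0)))))).

(** [F], a set of codes of pairs, is a function from [V] to the numbers. *)
Definition Function (V F : nat) : form :=
  AllN (#0 ∈ F ⇒ ExN (ExN (#1 ∈ V ∧ #2 == pair #1 #0)))
  ∧ AllN (#0 ∈ V ⇒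
      ExN (pair #1 #0 ∈ F ∧ AllN (pair #2 #0 ∈ F ⇒ #0 == #1))).

(** F(s) = F(t). *)
Definition SameValue (F : nat) (s t : term) : form :=
  ExN (pair (lift 1 s) #0 ∈ F ∧ pair (lift 1 t) #0 ∈ F).

Definition Decomposition (V E F : nat) : form :=
  Function V F
  ∧ AllN (AllN (#1 ∈ V ⇒ #0 ∈ V ⇒ Not (#1 == #0) ⇒
      (SameValue F #1 #0 ⇔ Path E #1 #0))).

(** Nonemptiness excludes the empty set, which has the other properties
    vacuously. *)
Definition Component (V E C : nat) : form :=
  ExN (#0 ∈ C)
  ∧ Subset C V
  ∧ AllN (AllN (#1 ∈ C ⇒ #0 ∈ C ⇒ Path E #1 #0))
  ∧ AllN (AllN (#1 ∈ C ⇒ #0 ∈ V ⇒ Path E #1 #0 ⇒ #0 ∈ C)).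

(* Main.v *)
From Stdlib Require Import List Arith Lia Cantor Classical ClassicalEpsilon.
From Stdlib Require Import FunctionalExtensionality PropExtensionality ProofIrrelevance.
From Stdlib Require Import Ring Setoid Morphisms_Prop.
Require Import Defs.
Import ListNotations.
Local Open Scope nat_scope.

(** By Goedel's completeness theorem (Henkin construction) it suffices to argue
    in an arbitrary, possibly nonstandard, model of RCA_0.

    There, call [v] in V_0 a representative if no smaller element of V_0 is
    connected to it.  The set of non-representatives is bounded and Sigma^0_1,
    so it exists; hence "[v] is a representative" is a Delta^0_1 condition.
    Every vertex [x] is connected to exactly one representative (the least
    element of V_0 connected to [x], by the Sigma^0_1 least number principle),
    and mapping [x] to it is the required function [F]: it is Sigma^0_1, and
    [F x <> v] holds iff [x] is connected to a representative other than [v].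
    A component is a fibre of [F]. *)

(** The obstacle is the weakness of the induction that the model provides: a predicate can serve for
    induction, minimization or comprehension only once it is known to be Sigma^0_1 or Delta^0_0 with
    parameters. Hence the calculus of [tdef], [ddef] and [sdef], which produces the formulas behind
    semantic statements. Connectedness is an existential statement about beta codes, so reversing or
    joining paths means coding new sequences; for this the Chinese remainder theorem is proved
    inside the model, from the semiring laws up and without subtraction. The same moduli serve a
    second time, to code the bounded Sigma^0_1 set of non-representatives by numbers. Being a
    representative, Pi^0_1 by definition, thereby becomes Delta^0_0 in two number parameters, and
    this is what brings both F and its complement into Sigma^0_1 form. *)

Definition scons {A : Type} (x : A) (f : nat -> A) (n : nat) : A :=
  match n with 0 => x | S n => f n end.
Notation "x .: f" := (scons x f) (at level 55, f at level 55, right associativity).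

Lemma scons_eta A (f : nat -> A) : f 0 .: (fun n => f (S n)) = f.
Proof. apply functional_extensionality; intros [|n]; reflexivity. Qed.

(** * Substitution *)

(** A strict upper bound for the free indices. An index at or above it is fresh, and a formula with
    bounds 0 is closed. *)
Fixpoint fvt (t : term) : nat :=
  match t with
  | Var n => S n
  | Zero | One => 0
  | Add s t | Mul s t => Nat.max (fvt s) (fvt t)
  end.

Fixpoint fvN (p : form) : nat :=
  match p with
  | Eq s t | Lt s t => Nat.max (fvt s) (fvt t)
  | Mem t _ => fvt t
  | Bot => 0
  | Imp p q => Nat.max (fvN p) (fvN q)
  | AllN p => pred (fvN p)
  | AllS p => fvN p
  end.

Fixpoint fvS (p : form) : nat :=
  match p with
  | Eq _ _ | Lt _ _ | Bot => 0
  | Mem _ X => S X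
  | Imp p q => Nat.max (fvS p) (fvS q)
  | AllN p => fvS p
  | AllS p => pred (fvS p)
  end.

Lemma tsubst_ext f g t :
  (forall n, n < fvt t -> f n = g n) -> tsubst f t = tsubst g t.
Proof.
  induction t; simpl; intros H; auto; f_equal; 
    (apply IHt1 || apply IHt2); intros; apply H; lia.
Qed.

Lemma tsubst_comp f g t :
  tsubst g (tsubst f t) = tsubst (fun n => tsubst g (f n)) t.
Proof. induction t; simpl; congruence. Qed.

Lemma tsubst_id t : tsubst Var t = t.
Proof. induction t; simpl; congruence. Qed.

Lemma lift_inst s t :
  tsubst (fun n => match n with 0 => s | S n => #n end) (lift 1 t) = t.
Proof. unfold lift; rewrite tsubst_comp; apply tsubst_id. Qed.

Ltac simpl_inst E := unfold instN in E; simpl in E; rewrite ?lift_inst in E.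

Lemma tsubst_up_lift f t : tsubst (upN f) (lift 1 t) = lift 1 (tsubst f t).
Proof. unfold lift; rewrite !tsubst_comp; reflexivity. Qed.

Lemma subst_ext p : forall f g r r',
  (forall n, n < fvN p -> f n = g n) -> (forall n, n < fvS p -> r n = r' n) ->
  subst f r p = subst g r' p.
Proof.
  induction p; simpl; intros f g r r' Hf Hr;
    try (f_equal; solve [apply tsubst_ext; intros; apply Hf; lia | apply Hr; lia]).
  - reflexivity.
  - f_equal; [apply IHp1 | apply IHp2]; intros; (apply Hf || apply Hr); lia.
  - f_equal; apply IHp; auto. intros [|n] Hn; simpl; auto.
    rewrite Hf by lia; reflexivity.
  - f_equal; apply IHp; auto. intros [|n] Hn; simpl; auto.
    rewrite Hr by lia; reflexivity.
Qed.

Lemma upN_comp f g :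
  (fun n => tsubst (upN g) (upN f n)) = upN (fun n => tsubst g (f n)).
Proof.
  apply functional_extensionality; intros [|n]; simpl; auto using tsubst_up_lift.
Qed.

Lemma upS_comp r s : (fun n => upS s (upS r n)) = upS (fun n => s (r n)).
Proof. apply functional_extensionality; intros [|n]; reflexivity. Qed.

Lemma subst_comp p : forall f g r r',
  subst g r' (subst f r p) = subst (fun n => tsubst g (f n)) (fun n => r' (r n)) p.
Proof.
  induction p; simpl; intros f g r r'; rewrite ?tsubst_comp; auto.
  - now rewrite IHp1, IHp2.
  - now rewrite IHp, upN_comp.
  - now rewrite IHp, upS_comp.
Qed.

Lemma subst_id p : subst Var (fun n => n) p = p.
Proof.
  induction p; simpl; rewrite ?tsubst_id; auto; try congruence.
  - rewrite <- IHp at 2; f_equal; apply subst_ext; auto.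
    intros [|n] _; reflexivity.
  - rewrite <- IHp at 2; f_equal; apply subst_ext; auto.
    intros [|n] _; reflexivity.
Qed.

Lemma subst_liftN f r p : subst (upN f) r (liftN p) = liftN (subst f r p).
Proof. unfold liftN; now rewrite !subst_comp. Qed.

Lemma subst_liftS f r p : subst f (upS r) (liftS p) = liftS (subst f r p).
Proof.
  unfold liftS; rewrite !subst_comp. simpl. f_equal.
  apply functional_extensionality; intros n; now rewrite tsubst_id.
Qed.

Lemma inst_upN f r t p : instN t (subst (upN f) r p) = subst (t .: f) r p.
Proof.
  unfold instN; rewrite subst_comp; apply subst_ext; auto.
  intros [|n] _; simpl; auto. apply lift_inst.
Qed.

Lemma inst_upS f r Y p : instS Y (subst f (upS r) p) = subst f (Y .: r) p.
Proof.
  unfold instS; rewrite subst_comp; apply subst_ext.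
  - intros; apply tsubst_id.
  - intros [|n] _; reflexivity.
Qed.

Lemma subst_instN f r t p :
  subst f r (instN t p) = instN (tsubst f t) (subst (upN f) r p).
Proof.
  rewrite inst_upN; unfold instN; rewrite subst_comp; apply subst_ext; auto.
  intros [|n] _; reflexivity.
Qed.

Lemma subst_instS f r Y p :
  subst f r (instS Y p) = instS (r Y) (subst f (upS r) p).
Proof.
  rewrite inst_upS; unfold instS; rewrite subst_comp; apply subst_ext; auto.
  intros [|n] _; reflexivity.
Qed.

(** * Derivations *)

Lemma proves_weaken T G p : proves T G p -> forall G', incl G G' -> proves T G' p.
Proof.
  induction 1; intros G' HG; eauto using proves.
  - apply pImpI, IHproves. intros q' [|]; simpl; auto.
  - apply pRaa, IHproves. intros q' [|]; simpl; auto.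
  - apply pAllNI, IHproves. now apply incl_map.
  - apply pAllSI, IHproves. now apply incl_map.
Qed.

Lemma proves_theory T T' G p :
  (forall q, T q -> proves T' [] q) -> proves T G p -> proves T' G p.
Proof.
  intros HT; induction 1; eauto using proves.
  apply proves_weaken with []; auto. apply incl_nil_l.
Qed.

Definition sentence (p : form) : Prop := forall f r, subst f r p = p.

(** Axioms are copied unchanged into the substituted derivation, so they have to be closed. *)
Lemma proves_subst T G p :
  (forall q, T q -> sentence q) -> proves T G p ->
  forall f r, proves T (map (subst f r) G) (subst f r p).
Proof.
  intros HT; induction 1; intros f r; simpl.
  - rewrite HT by auto. now apply pAx.
  - apply pHyp. now apply in_map.
  - apply pImpI, IHproves.
  - eapply pImpE; [apply IHproves1 | apply IHproves2].
  - apply pRaa, IHproves.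
  - apply pAllNI. specialize (IHproves (upN f) r). rewrite map_map in *.
    erewrite map_ext; [exact IHproves|]. intros; simpl. now rewrite subst_liftN.
  - rewrite subst_instN. apply pAllNE, IHproves.
  - apply pAllSI. specialize (IHproves f (upS r)). rewrite map_map in *.
    erewrite map_ext; [exact IHproves|]. intros; simpl. now rewrite subst_liftS.
  - rewrite subst_instS. apply pAllSE, IHproves.
  - apply pEqRefl.
  - rewrite subst_instN. eapply pEqSubst; [apply IHproves1|].
    rewrite <- subst_instN. apply IHproves2.
Qed.

Definition closure (p : form) : form :=
  Nat.iter (fvN p) AllN (Nat.iter (fvS p) AllS p).

(** In the empty context the generalization rules carry no eigenvariable condition, so an axiom may
    be generalized over all its variables. *)
Lemma proves_closure T p : T p -> proves T [] (closure p).
Proof.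
  intros Hp; unfold closure.
  induction (fvN p) as [|n IHn]; simpl; [|now apply pAllNI].
  induction (fvS p) as [|m IHm]; simpl; [|now apply pAllSI].
  now apply pAx.
Qed.

(** The quantifier prefix lowers both bounds to 0, and then every substitution agrees with the
    identity on the free variables. *)
Lemma sentence_closure p : sentence (closure p).
Proof.
  enough (H : fvN (closure p) = 0 /\ fvS (closure p) = 0).
  { intros f r. rewrite <- (subst_id (closure p)) at 2.
    apply subst_ext; intros; lia. }
  unfold closure.
  assert (HS : forall m q, fvN (Nat.iter m AllS q) = fvN q /\
                           fvS (Nat.iter m AllS q) = fvS q - m).
  { induction m as [|m IH]; intros q; simpl; [lia|].
    destruct (IH q); lia. }
  assert (HN : forall m q, fvN (Nat.iter m AllN q) = fvN q - m /\
                           fvS (Nat.iter m AllN q) = fvS q).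
  { induction m as [|m IH]; intros q; simpl; [lia|].
    destruct (IH q); lia. }
  destruct (HN (fvN p) (Nat.iter (fvS p) AllS p)), (HS (fvS p) p); lia.
Qed.

(** * Structures *)

Record structure := Structure {
  num : Type;
  sets : Type;
  zero : num;
  one : num;
  add : num -> num -> num;
  mul : num -> num -> num;
  lt : num -> num -> Prop;
  mem : num -> sets -> Prop }.

Arguments zero {_}.
Arguments one {_}.
Arguments add {_}.
Arguments mul {_}.
Arguments lt {_}.
Arguments mem {_}.

Fixpoint eval {M : structure} (e : nat -> num M) (t : term) : num M :=
  match t with
  | Var n => e n
  | Zero => zero
  | One => one
  | Add s t => add (eval e s) (eval e t)
  | Mul s t => mul (eval e s) (eval e t)
  end.

Fixpoint sat {M : structure} (e : nat -> num M) (c : nat -> sets M) (p : form) : Prop :=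
  match p with
  | Eq s t => eval e s = eval e t
  | Lt s t => lt (eval e s) (eval e t)
  | Mem t X => mem (eval e t) (c X)
  | Bot => False
  | Imp p q => sat e c p -> sat e c q
  | AllN p => forall x, sat (x .: e) c p
  | AllS p => forall X, sat e (X .: c) p
  end.

Definition valid (M : structure) (p : form) : Prop :=
  forall e c, @sat M e c p.

Lemma valid_closure M p : valid M (closure p) -> valid M p.
Proof.
  unfold closure.
  induction (fvN p) as [|n IHn]; simpl; intros H.
  - induction (fvS p) as [|m IHm]; simpl in H; auto.
    (* The outer quantifier is instantiated with the value that the environment already gives to
       index 0. *)
    apply IHm. intros e c. rewrite <- (scons_eta _ c). apply H.
  - apply IHn. intros e c. rewrite <- (scons_eta _ e). apply H.
Qed.

(** * Completeness *)

Section Henkin.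

Variable T : form -> Prop.
Hypothesis T_sentence : forall p, T p -> sentence p.

Definition consistent (G : list form) : Prop := ~ proves T G Bot.

(** Renaming [k] to 0 and shifting all other variables turns [instN #k q] into [q]
    and lifts the context. *)
Lemma fresh_witnessN G q k :
  (forall p, In p G -> fvN p <= k) -> fvN q <= k ->
  proves T (Not (instN #k q) :: G) Bot -> proves T G (AllN q).
Proof.
  intros HG Hq H. apply pRaa in H.
  apply proves_subst with
    (f := fun i => if i =? k then #0 else #(S i)) (r := fun X => X) in H; auto.
  apply pAllNI.
  replace (map liftN G) with
    (map (subst (fun i => if i =? k then #0 else #(S i)) (fun X => X)) G).
  - replace q with (subst (fun i => if i =? k then #0 else #(S i)) (fun X => X)
      (instN #k q)); auto.
    unfold instN. rewrite subst_comp. rewrite <- (subst_id q) at 2.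
    apply subst_ext; auto. intros [|n] Hn; simpl.
    + now rewrite Nat.eqb_refl.
    + destruct (Nat.eqb_spec n k); auto; lia.
  - apply map_ext_in. intros p Hp. apply subst_ext; auto.
    intros n Hn. specialize (HG _ Hp). destruct (Nat.eqb_spec n k); auto; lia.
Qed.

Lemma fresh_witnessS G q k :
  (forall p, In p G -> fvS p <= k) -> fvS q <= k ->
  proves T (Not (instS k q) :: G) Bot -> proves T G (AllS q).
Proof.
  intros HG Hq H. apply pRaa in H.
  apply proves_subst with
    (f := Var) (r := fun X => if X =? k then 0 else S X) in H; auto.
  apply pAllSI.
  replace (map liftS G) with
    (map (subst Var (fun X => if X =? k then 0 else S X)) G).
  - replace q with (subst Var (fun X => if X =? k then 0 else S X) (instS k q)); auto.
    unfold instS. rewrite subst_comp. rewrite <- (subst_id q) at 2.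
    apply subst_ext; auto. intros [|n] Hn; simpl.
    + now rewrite Nat.eqb_refl.
    + destruct (Nat.eqb_spec n k); auto; lia.
  - apply map_ext_in. intros p Hp. apply subst_ext; auto.
    intros n Hn. specialize (HG _ Hp). destruct (Nat.eqb_spec n k); auto; lia.
Qed.

Definition bound (h : form -> nat) (G : list form) : nat := list_max (map h G).

Lemma bound_In h G p : In p G -> h p <= bound h G.
Proof.
  intros Hp. unfold bound.
  pose proof (proj1 (list_max_le (map h G) _) (le_n _)) as H.
  rewrite Forall_forall in H. apply H, in_map, Hp.
Qed.

(** Variables serve as Henkin constants: only finitely many formulas are present at a time, so a
    fresh index exists. The [S] accounts for the variable bound in [AllN q] or [AllS q], which is
    free in [q]. *)
Definition witness (p : form) (G : list form) : list form :=
  match p with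
  | Imp (AllN q) Bot => [Not (instN #(S (bound fvN (p :: G))) q)]
  | Imp (AllS q) Bot => [Not (instS (S (bound fvS (p :: G))) q)]
  | _ => []
  end.

(** By [fresh_witnessN] and [fresh_witnessS], an inconsistency would prove the universal formula
    that [p] negates. *)
Lemma witness_consistent p G :
  consistent (p :: G) -> consistent (witness p G ++ p :: G).
Proof.
  intros H. destruct p as [| | | |p1 p2| |]; try exact H.
  destruct p1 as [| | | | |q|q]; try exact H;
    destruct p2; try exact H; intros HB; apply H;
    (eapply pImpE; [apply pHyp; left; reflexivity|]).
  - refine (fresh_witnessN _ _ _ _ _ HB).
    + intros p Hp. apply Nat.le_le_succ_r, bound_In, Hp.
    + pose proof (bound_In fvN ((AllN q ⇒ Bot) :: G) _ (or_introl eq_refl)).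
      simpl in *; lia.
  - refine (fresh_witnessS _ _ _ _ _ HB).
    + intros p Hp. apply Nat.le_le_succ_r, bound_In, Hp.
    + pose proof (bound_In fvS ((AllS q ⇒ Bot) :: G) _ (or_introl eq_refl)).
      simpl in *; lia.
Qed.

(** Formulas are numbered so that they can be considered for acceptance one after another. *)
Fixpoint tcode (t : term) : nat :=
  match t with
  | Var n => to_nat (0, n)
  | Zero => to_nat (1, 0)
  | One => to_nat (2, 0)
  | Add s t => to_nat (3, to_nat (tcode s, tcode t))
  | Mul s t => to_nat (4, to_nat (tcode s, tcode t))
  end.

Fixpoint code (p : form) : nat :=
  match p with
  | Eq s t => to_nat (0, to_nat (tcode s, tcode t))
  | Lt s t => to_nat (1, to_nat (tcode s, tcode t))
  | Mem t X => to_nat (2, to_nat (tcode t, X))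
  | Bot => to_nat (3, 0)
  | Imp p q => to_nat (4, to_nat (code p, code q))
  | AllN p => to_nat (5, code p)
  | AllS p => to_nat (6, code p)
  end.

Lemma to_nat_inj p q : to_nat p = to_nat q -> p = q.
Proof. intros H. now rewrite <- (cancel_of_to p), H, cancel_of_to. Qed.

Ltac code_inj :=
  repeat match goal with
  | H : to_nat _ = to_nat _ |- _ => apply to_nat_inj in H
  | H : (_, _) = (_, _) |- _ =>
      apply pair_equal_spec in H; destruct H as [? H]
  end.

Lemma tcode_inj s : forall t, tcode s = tcode t -> s = t.
Proof.
  induction s; intros []; cbn [tcode]; intros H; code_inj; try discriminate; f_equal; auto.
Qed.

Lemma code_inj p : forall q, code p = code q -> p = q.
Proof.
  induction p; intros []; cbn [code]; intros H; code_inj; try discriminate; f_equal;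
    auto using tcode_inj.
Qed.

(** A number that codes nothing yields some arbitrary formula; this is harmless, as every formula
    still gets its turn at its own code. *)
Definition decode (n : nat) : form := epsilon (inhabits Bot) (fun p => code p = n).

Lemma decode_code p : decode (code p) = p.
Proof. apply code_inj. unfold decode. apply epsilon_spec. now exists p. Qed.

Variable p0 : form.
Hypothesis p0_unprovable : ~ proves T [] p0.

(** Lindenbaum's construction, in which each accepted formula brings its Henkin witness along. *)
Fixpoint stage (n : nat) : list form :=
  match n with
  | 0 => [Not p0]
  | S n =>
    if excluded_middle_informative (consistent (decode n :: stage n))
    then witness (decode n) (stage n) ++ decode n :: stage n else stage n
  end.

Definition henkin (p : form) : Prop := exists n, In p (stage n).

Lemma stage_incl m n : m <= n -> incl (stage m) (stage n).
Proof.
  induction 1 as [|n _ IH]; [apply incl_refl|]. simpl.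
  destruct excluded_middle_informative; auto.
  apply incl_appr, incl_tl, IH.
Qed.

Lemma stage_consistent n : consistent (stage n).
Proof.
  induction n as [|n IH]; simpl.
  - intros H. now apply p0_unprovable, pRaa.
  - destruct excluded_middle_informative; auto using witness_consistent.
Qed.

Lemma henkin_incl G :
  (forall p, In p G -> henkin p) -> exists n, incl G (stage n).
Proof.
  induction G as [|p G IH]; intros HG.
  - exists 0. apply incl_nil_l.
  - destruct IH as [n Hn]; [intros; apply HG; now right|].
    destruct (HG p) as [m Hm]; [now left|].
    exists (Nat.max m n). apply incl_cons.
    + apply (stage_incl m); auto; lia.
    + eapply incl_tran; [exact Hn|]. apply stage_incl; lia.
Qed.

(** At its turn [p] is accepted: were it inconsistent with that stage, a stage containing both that
    one and [G] would prove [p] and refute it. *)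
Lemma henkin_closed G p :
  (forall q, In q G -> henkin q) -> proves T G p -> henkin p.
Proof.
  intros HG Hp. destruct (henkin_incl G HG) as [m Hm].
  exists (S (code p)). simpl. rewrite decode_code.
  destruct excluded_middle_informative as [|Hn].
  - apply in_or_app; right; now left.
  - exfalso. apply NNPP in Hn.
    apply (stage_consistent (Nat.max m (code p))).
    eapply pImpE; [apply pImpI|].
    + eapply proves_weaken; [exact Hn|]. apply incl_cons; [now left|].
      apply incl_tl, stage_incl; lia.
    + eapply proves_weaken; [exact Hp|]. eapply incl_tran; [exact Hm|].
      apply stage_incl; lia.
Qed.

Lemma henkin_mp p q : henkin (p ⇒ q) -> henkin p -> henkin q.
Proof.
  intros H1 H2. apply henkin_closed with [p ⇒ q; p].
  - intros r [<-|[<-|[]]]; auto.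
  - apply pImpE with p; apply pHyp; simpl; auto.
Qed.

Lemma henkin_prove p : proves T [] p -> henkin p.
Proof. apply henkin_closed. intros _ []. Qed.

Lemma henkin_Bot : ~ henkin Bot.
Proof. intros [n Hn]. apply (stage_consistent n), pHyp, Hn. Qed.

(** If [p] were rejected at its turn, the stage would prove [Not p]. The equation exposes the
    witness added together with [p]. *)
Lemma henkin_step p :
  ~ henkin (Not p) ->
  exists n, stage (S n) = witness p (stage n) ++ p :: stage n.
Proof.
  intros H. exists (code p). simpl. rewrite decode_code.
  destruct excluded_middle_informative as [|Hn]; auto.
  exfalso. apply H. apply henkin_closed with (stage (code p)).
  - intros q Hq. now exists (code p).
  - apply pImpI. now apply NNPP in Hn.
Qed.

Lemma henkin_complete p : ~ henkin p -> henkin (Not p).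
Proof.
  intros H. apply NNPP; intros Hn. apply H.
  destruct (henkin_step p Hn) as [n E]. exists (S n). rewrite E.
  apply in_or_app; right; now left.
Qed.

Lemma henkin_not_not p : henkin (Not (Not p)) -> henkin p.
Proof.
  intros H. apply henkin_closed with [Not (Not p)].
  - intros r [<-|[]]; auto.
  - apply pRaa. apply pImpE with (Not p); apply pHyp; simpl; auto.
Qed.

(** Were [AllN q] missing, its negation would have entered at some stage together with a negated
    instance of [q]. *)
Lemma henkin_AllN q : (forall t, henkin (instN t q)) -> henkin (AllN q).
Proof.
  intros H. apply NNPP; intros Hn.
  destruct (henkin_step (Not (AllN q))) as [n E].
  { intros H'. now apply Hn, henkin_not_not. }
  apply henkin_Bot. eapply henkin_mp; [|apply H].
  exists (S n). rewrite E. left. reflexivity.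
Qed.

Lemma henkin_AllS q : (forall Y, henkin (instS Y q)) -> henkin (AllS q).
Proof.
  intros H. apply NNPP; intros Hn.
  destruct (henkin_step (Not (AllS q))) as [n E].
  { intros H'. now apply Hn, henkin_not_not. }
  apply henkin_Bot. eapply henkin_mp; [|apply H].
  exists (S n). rewrite E. left. reflexivity.
Qed.

Lemma henkin_rewrite p s t :
  henkin (s == t) -> henkin (instN s p) -> henkin (instN t p).
Proof.
  intros H1 H2. apply henkin_closed with [s == t; instN s p].
  - intros r [<-|[<-|[]]]; auto.
  - apply pEqSubst with s; apply pHyp; simpl; auto.
Qed.

Lemma henkin_refl t : henkin (t == t).
Proof. apply henkin_prove, pEqRefl. Qed.

Lemma henkin_sym s t : henkin (s == t) -> henkin (t == s).
Proof.
  intros H.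
  pose proof (henkin_rewrite (#0 == lift 1 s) s t H) as E.
  simpl_inst E.
  apply E, henkin_refl.
Qed.

(** Since [sat] reads [Eq] as identity, terms are taken modulo the equations in [henkin]. A class is
    a predicate on terms, so that extensionality identifies the classes of equal terms. *)
Definition point : Type := {c : term -> Prop | exists t, c = fun s => henkin (s == t)}.

Definition class (t : term) : point :=
  exist _ (fun s => henkin (s == t)) (ex_intro _ t eq_refl).

Lemma class_eq s t : class s = class t <-> henkin (s == t).
Proof.
  split; intros H.
  - apply (f_equal (fun c => proj1_sig c s)) in H. simpl in H.
    rewrite <- H. apply henkin_refl.
  - apply subset_eq_compat. apply functional_extensionality; intros u.
    apply propositional_extensionality. split; intros Hu.
    + pose proof (henkin_rewrite (lift 1 u == #0) s t H) as E.
      simpl_inst E. auto.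
    + pose proof (henkin_rewrite (lift 1 u == #0) t s (henkin_sym _ _ H)) as E.
      simpl_inst E. auto.
Qed.

Definition repr (d : point) : term :=
  proj1_sig (constructive_indefinite_description _ (proj2_sig d)).

Lemma class_repr d : class (repr d) = d.
Proof.
  unfold repr. destruct constructive_indefinite_description as [t Ht]; simpl.
  destruct d as [c Hc]; simpl in *. now apply subset_eq_compat.
Qed.

(** Set variables themselves serve as sets: the language has no equality of sets, so no quotient is
    taken there. *)
Definition term_model : structure := {|
  num := point;
  sets := nat;
  zero := class Zero;
  one := class One;
  add a b := class (repr a + repr b)%so;
  mul a b := class (repr a * repr b)%so;
  lt a b := henkin (repr a < repr b)%so;
  mem a X := henkin (repr a ∈ X) |}.

Lemma repr_class t : henkin (repr (class t) == t).
Proof. apply class_eq, class_repr. Qed.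

Lemma eval_term_model f t :
  @eval term_model (fun n => class (f n)) t = class (tsubst f t).
Proof.
  induction t; simpl; auto; rewrite IHt1, IHt2; apply class_eq.
  - set (a := tsubst f t1); set (b := tsubst f t2).
    (* One argument is rewritten at a time, starting from a reflexive equation. *)
    pose proof (henkin_rewrite (lift 1 (repr (class a)) + lift 1 (repr (class b))
      == #0 + lift 1 (repr (class b))) _ _ (repr_class a)) as E1.
    pose proof (henkin_rewrite (lift 1 (repr (class a)) + lift 1 (repr (class b))
      == lift 1 a + #0) _ _ (repr_class b)) as E2.
    simpl_inst E1; simpl_inst E2.
    apply E2, E1, henkin_refl.
  - set (a := tsubst f t1); set (b := tsubst f t2).
    pose proof (henkin_rewrite (lift 1 (repr (class a)) * lift 1 (repr (class b))
      == #0 * lift 1 (repr (class b))) _ _ (repr_class a)) as E1.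
    pose proof (henkin_rewrite (lift 1 (repr (class a)) * lift 1 (repr (class b))
      == lift 1 a * #0) _ _ (repr_class b)) as E2.
    simpl_inst E1; simpl_inst E2.
    apply E2, E1, henkin_refl.
Qed.

Lemma henkin_congr_iff p s t :
  henkin (s == t) -> henkin (instN s p) <-> henkin (instN t p).
Proof.
  intros H; split; apply henkin_rewrite; auto using henkin_sym.
Qed.

(** The truth lemma. Generality in [f] and [r] lets the quantifier cases absorb the new element into
    the substitution. *)
Lemma sat_term_model p : forall f r,
  @sat term_model (fun n => class (f n)) r p <-> henkin (subst f r p).
Proof.
  induction p; intros f r; simpl.
  - rewrite !eval_term_model. apply class_eq.
  - rewrite !eval_term_model.
    set (a := tsubst f s); set (b := tsubst f t).
    pose proof (henkin_congr_iff (#0 < lift 1 (repr (class b))) _ _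
      (repr_class a)) as E1.
    pose proof (henkin_congr_iff (lift 1 a < #0) _ _ (repr_class b)) as E2.
    simpl_inst E1; simpl_inst E2.
    tauto.
  - rewrite !eval_term_model.
    exact (henkin_congr_iff (#0 ∈ r X) _ _ (repr_class (tsubst f t))).
  - split; [tauto|apply henkin_Bot].
  - rewrite IHp1, IHp2. split; [|apply henkin_mp].
    (* By completeness of [henkin], either the conclusion or the negated premise is available, and
       each yields the implication. *)
    intros H. destruct (classic (henkin (subst f r p1))) as [H1|H1].
    + apply henkin_closed with [subst f r p2].
      * intros q [<-|[]]; auto.
      * apply pImpI, pHyp. simpl; auto.
    + apply henkin_complete in H1.
      apply henkin_closed with [Not (subst f r p1)].
      * intros q [<-|[]]; auto.
      * apply pImpI, pRaa. apply pImpE with (subst f r p1); apply pHyp; simpl; auto.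
  (* Every point is the class of a term, so quantifying over points amounts to quantifying over
     terms. *)
  - transitivity (forall t, henkin (instN t (subst (upN f) r p))).
    + assert (E : forall t, (class t .: fun n => class (f n)) =
                            fun n => class ((t .: f) n)).
      { intros t. apply functional_extensionality; intros [|n]; reflexivity. }
      split; intros H t.
      * rewrite inst_upN. apply IHp. rewrite <- E. apply (H (class t)).
      * rewrite <- (class_repr t), E. apply IHp. rewrite <- inst_upN. apply H.
    + split; [apply henkin_AllN|]. intros H t.
      apply henkin_closed with [AllN (subst (upN f) r p)].
      * intros q [<-|[]]; auto.
      * apply pAllNE, pHyp. simpl; auto.
  - transitivity (forall Y, henkin (instS Y (subst f (upS r) p))).
    + split; intros H Y; specialize (H Y).
      * rewrite inst_upS. now apply IHp.
      * rewrite inst_upS in H. now apply IHp.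
    + split; [apply henkin_AllS|]. intros H Y.
      apply henkin_closed with [AllS (subst f (upS r) p)].
      * intros q [<-|[]]; auto.
      * apply pAllSE, pHyp. simpl; auto.
Qed.

Lemma term_model_theory p : T p -> valid term_model p.
Proof.
  intros Hp e c.
  replace e with (fun n => class (repr (e n))).
  - apply sat_term_model. rewrite T_sentence by auto.
    now apply henkin_prove, pAx.
  - apply functional_extensionality; intros; apply class_repr.
Qed.

Lemma term_model_refutes : ~ valid term_model p0.
Proof.
  intros H. specialize (H (fun n => class #n) (fun X => X)).
  apply sat_term_model in H. rewrite subst_id in H.
  apply henkin_Bot. apply henkin_mp with p0; auto. exists 0. now left.
Qed.

End Henkin.

Theorem completeness T p :
  (forall M, (forall q, T q -> valid M q) -> valid M p) -> provable T p.
Proof.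
  intros H. apply NNPP; intros Hp.
  (* The Henkin construction works with sentences, so each axiom is replaced by its universal
     closure, which is derivable from it and, by [valid_closure], implies it. *)
  pose (T' := fun q => exists q', T q' /\ q = closure q').
  assert (HT' : forall q, T' q -> sentence q).
  { intros q [q' [_ ->]]. apply sentence_closure. }
  assert (Hp' : ~ proves T' [] p).
  { intros Hn. apply Hp. revert Hn. apply proves_theory.
    intros q [q' [Hq ->]]. now apply proves_closure. }
  apply (term_model_refutes T' HT' p Hp'), H.
  intros q Hq. apply valid_closure, term_model_theory; auto.
  now exists q.
Qed.

(** * Semantics of substitution and of the defined connectives *)

Lemma eval_tsubst (M : structure) (e : nat -> num M) f t :
  eval e (tsubst f t) = eval (fun n => eval e (f n)) t.
Proof. induction t; simpl; congruence. Qed.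

Lemma sat_subst (M : structure) p : forall (e : nat -> num M) c f r,
  sat e c (subst f r p) <-> sat (fun n => eval e (f n)) (fun X => c (r X)) p.
Proof.
  induction p; intros e c f r; simpl; rewrite ?eval_tsubst; try tauto.
  - now rewrite IHp1, IHp2.
  - split; intros H x; specialize (H x); rewrite IHp in *.
    + replace (x .: fun n => eval e (f n))
        with (fun n => eval (x .: e) (upN f n)); auto.
      apply functional_extensionality; intros [|n]; simpl; auto.
      unfold lift; rewrite eval_tsubst; reflexivity.
    + replace (fun n => eval (x .: e) (upN f n))
        with (x .: fun n => eval e (f n)); auto.
      apply functional_extensionality; intros [|n]; simpl; auto.
      unfold lift; rewrite eval_tsubst; reflexivity.
  - split; intros H X; specialize (H X); rewrite IHp in *.
    + replace (X .: fun n => c (r n)) with (fun n => (X .: c) (upS r n)); auto.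
      apply functional_extensionality; intros [|n]; reflexivity.
    + replace (fun n => (X .: c) (upS r n)) with (X .: fun n => c (r n)); auto.
      apply functional_extensionality; intros [|n]; reflexivity.
Qed.

Lemma Delta00_subst p : Delta00 p -> forall f r, Delta00 (subst f r p).
Proof.
  induction 1; intros f r; simpl; try (constructor; auto; fail).
  - rewrite tsubst_up_lift. now apply dAllB.
  - rewrite tsubst_up_lift. now apply (dExB (tsubst f t)).
Qed.

Lemma sat_And (M : structure) (e : nat -> num M) c p q :
  sat e c (p ∧ q) <-> sat e c p /\ sat e c q.
Proof. simpl; tauto. Qed.

Lemma sat_Or (M : structure) (e : nat -> num M) c p q :
  sat e c (p ∨ q) <-> sat e c p \/ sat e c q.
Proof. simpl; tauto. Qed.

Lemma sat_Iff (M : structure) (e : nat -> num M) c p q :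
  sat e c (p ⇔ q) <-> (sat e c p <-> sat e c q).
Proof. simpl; tauto. Qed.

Lemma sat_ExN (M : structure) (e : nat -> num M) c p :
  sat e c (ExN p) <-> exists x, sat (x .: e) c p.
Proof.
  simpl; split.
  - intros H. apply NNPP; intros Hn. apply H. intros x Hx. apply Hn. now exists x.
  - intros [x Hx] H. now apply (H x).
Qed.

Lemma sat_ExS (M : structure) (e : nat -> num M) c p :
  sat e c (ExS p) <-> exists X, sat e (X .: c) p.
Proof.
  simpl; split.
  - intros H. apply NNPP; intros Hn. apply H. intros x Hx. apply Hn. now exists x.
  - intros [x Hx] H. now apply (H x).
Qed.

Lemma eval_lift (M : structure) (e : nat -> num M) k t :
  eval e (lift k t) = eval (fun n => e (k + n)%nat) t.
Proof. unfold lift; now rewrite eval_tsubst. Qed.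

Lemma sat_AllB (M : structure) (e : nat -> num M) c t p :
  sat e c (AllB t p) <-> forall x, lt x (eval e t) -> sat (x .: e) c p.
Proof.
  unfold AllB; simpl. split; intros H x; specialize (H x); rewrite eval_lift in *;
    exact H.
Qed.

Lemma sat_ExB (M : structure) (e : nat -> num M) c t p :
  sat e c (ExB t p) <-> exists x, lt x (eval e t) /\ sat (x .: e) c p.
Proof.
  unfold ExB; rewrite sat_ExN. split; intros [x H]; exists x;
  rewrite sat_And in *; simpl in *; rewrite eval_lift in *; exact H.
Qed.

(** * Definability with parameters *)

Section Definability.

Variable M : structure.
Notation N := (num M).
Notation env := (nat -> N).

Definition mix (d : nat) (e c : env) (i : nat) : N :=
  if i <? d then e i else c (i - d).

Lemma mix_lt d e c i : i < d -> mix d e c i = e i.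
Proof. intros H. unfold mix. now rewrite (proj2 (Nat.ltb_lt i d) H). Qed.

Lemma mix_add d e c i : mix d e c (d + i) = c i.
Proof.
  unfold mix. destruct (Nat.ltb_spec (d + i) d); [lia|].
  f_equal; lia.
Qed.

Lemma scons_mix d x e c : x .: mix d e c = mix (S d) (x .: e) c.
Proof. apply functional_extensionality; intros [|n]; reflexivity. Qed.

Definition lists {A : Type} (c : nat -> A) (l : list A) : Prop :=
  forall a, In a l -> exists i, c i = a.

Lemma lists_app {A} (c : nat -> A) l l' :
  lists c (l ++ l') <-> lists c l /\ lists c l'.
Proof.
  unfold lists; split.
  - intros H; split; intros a Ha; apply H, in_or_app; auto.
  - intros [H H'] a Ha. apply in_app_or in Ha as []; auto.
Qed.

Lemma lists_nth {A} (a0 : A) l : lists (fun i => nth i l a0) l.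
Proof.
  intros a Ha. destruct (In_nth l a a0 Ha) as [i [_ Hi]]. now exists i.
Qed.

(** The functions and predicates below depend on finitely many entries of an
    environment [e], and number and set constants may occur in them.  A term or
    formula for them, to be read in [mix d e c], has its first [d] variables in
    [e] and finds the constants, listed by [l] and [ls], among the values of [c]
    and [s].  As [c], [s] and [d] are arbitrary, any two terms or formulas can
    be combined, and binding a variable raises [d] by one. *)
Definition tdef (t : env -> N) : Prop :=
  exists l k, forall c, lists c l -> forall d, k <= d ->
  exists u, forall e, eval (mix d e c) u = t e.

Definition ddef (P : env -> Prop) : Prop :=
  exists l ls k, forall c s, lists c l -> lists s ls -> forall d, k <= d ->
  exists p, Delta00 p /\ forall e, sat (mix d e c) s p <-> P e.

Lemma tdef_const a : tdef (fun _ => a).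
Proof.
  exists [a], 0. intros c Hc d _. destruct (Hc a) as [i Hi]; [now left|].
  exists #(d + i). intros e. simpl. now rewrite mix_add.
Qed.

Lemma tdef_var n : tdef (fun e => e n).
Proof.
  exists [], (S n). intros c _ d Hd. exists #n. intros e. simpl. now rewrite mix_lt.
Qed.

Lemma tdef_add t u : tdef t -> tdef u -> tdef (fun e => add (t e) (u e)).
Proof.
  intros [l1 [k1 H1]] [l2 [k2 H2]]. exists (l1 ++ l2), (Nat.max k1 k2).
  intros c Hc d Hd. apply lists_app in Hc as [Hc1 Hc2].
  destruct (H1 c Hc1 d) as [u1 E1]; [lia|].
  destruct (H2 c Hc2 d) as [u2 E2]; [lia|].
  exists (Add u1 u2). intros e. simpl. now rewrite E1, E2.
Qed.

Lemma tdef_mul t u : tdef t -> tdef u -> tdef (fun e => mul (t e) (u e)).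
Proof.
  intros [l1 [k1 H1]] [l2 [k2 H2]]. exists (l1 ++ l2), (Nat.max k1 k2).
  intros c Hc d Hd. apply lists_app in Hc as [Hc1 Hc2].
  destruct (H1 c Hc1 d) as [u1 E1]; [lia|].
  destruct (H2 c Hc2 d) as [u2 E2]; [lia|].
  exists (Mul u1 u2). intros e. simpl. now rewrite E1, E2.
Qed.

(** In [tdef] the list of constants comes before the environment [c], so the lists of all the
    functions that [k] variables can refer to are merged into one. *)
Lemma tdef_family (f : nat -> env -> N) k :
  (forall n, tdef (f n)) ->
  exists l k', forall c, lists c l -> forall d, k' <= d ->
  exists u : nat -> term, forall i e, i < k -> eval (mix d e c) (u i) = f i e.
Proof.
  intros Hf. induction k as [|k IH].
  - exists [], 0. intros. exists Var. intros; lia.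
  - destruct IH as [l [k1 H1]]. destruct (Hf k) as [l2 [k2 H2]].
    exists (l ++ l2), (Nat.max k1 k2).
    intros c Hc d Hd. apply lists_app in Hc as [Hc1 Hc2].
    destruct (H1 c Hc1 d) as [u E1]; [lia|].
    destruct (H2 c Hc2 d) as [v E2]; [lia|].
    exists (fun i => if i =? k then v else u i). intros i e Hi.
    destruct (Nat.eqb_spec i k) as [->|]; auto. apply E1; lia.
Qed.

(** The first [k] indices are replaced by terms, while the constants move from offset [k] to offset
    [d]. *)
Lemma mix_subst (f : nat -> env -> N) (u : nat -> term) k d e c :
  (forall i e, i < k -> eval (mix d e c) (u i) = f i e) ->
  (fun n => eval (mix d e c) (if n <? k then u n else #(d + (n - k)))) =
  mix k (fun n => f n e) c.
Proof.
  intros H. apply functional_extensionality; intros n. unfold mix at 2.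
  destruct (Nat.ltb_spec n k); simpl; auto. apply mix_add.
Qed.

Lemma tdef_subst t (f : nat -> env -> N) :
  tdef t -> (forall n, tdef (f n)) -> tdef (fun e => t (fun n => f n e)).
Proof.
  intros [l [k H]] Hf. destruct (tdef_family f k Hf) as [l' [k' H']].
  exists (l ++ l'), k'. intros c Hc d Hd. apply lists_app in Hc as [Hc1 Hc2].
  destruct (H c Hc1 k) as [v E]; [lia|]. destruct (H' c Hc2 d Hd) as [u E'].
  exists (tsubst (fun n => if n <? k then u n else #(d + (n - k))) v).
  intros e. rewrite eval_tsubst, (mix_subst f) by auto. apply E.
Qed.

Lemma ddef_subst P (f : nat -> env -> N) :
  ddef P -> (forall n, tdef (f n)) -> ddef (fun e => P (fun n => f n e)).
Proof.
  intros [l [ls [k H]]] Hf. destruct (tdef_family f k Hf) as [l' [k' H']].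
  exists (l ++ l'), ls, k'. intros c s Hc Hs d Hd. apply lists_app in Hc as [Hc1 Hc2].
  destruct (H c s Hc1 Hs k) as [p [Hp E]]; [lia|].
  destruct (H' c Hc2 d Hd) as [u E'].
  exists (subst (fun n => if n <? k then u n else #(d + (n - k))) (fun X => X) p).
  split; [now apply Delta00_subst|].
  intros e. rewrite sat_subst, (mix_subst f) by auto. apply E.
Qed.

Lemma ddef_shift P : ddef P -> ddef (fun e => P (fun n => e (S n))).
Proof. intros H. apply (ddef_subst P (fun n e => e (S n)) H). intros; apply tdef_var. Qed.

Lemma ddef_iff P Q : (forall e, P e <-> Q e) -> ddef P -> ddef Q.
Proof.
  intros HPQ [l [ls [k H]]]. exists l, ls, k. intros c s Hc Hs d Hd.
  destruct (H c s Hc Hs d Hd) as [p [Hp E]]. exists p; split; auto.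
  intros e. now rewrite E.
Qed.

Ltac ddef_atom H1 H2 c d u1 E1 u2 E2 :=
  let l1 := fresh in let k1 := fresh in let l2 := fresh in let k2 := fresh in
  let Hc := fresh in let s := fresh in let Hd := fresh in
  destruct H1 as [l1 [k1 H1]]; destruct H2 as [l2 [k2 H2]];
  exists (l1 ++ l2), [], (Nat.max k1 k2);
  intros c s Hc _ d Hd; apply lists_app in Hc;
  destruct (H1 c (proj1 Hc) d) as [u1 E1]; [lia|];
  destruct (H2 c (proj2 Hc) d) as [u2 E2]; [lia|].

Lemma ddef_eq t u : tdef t -> tdef u -> ddef (fun e => t e = u e).
Proof.
  intros H1 H2. ddef_atom H1 H2 c d u1 E1 u2 E2.
  exists (Eq u1 u2); split; [constructor|]. intros e. simpl. now rewrite E1, E2.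
Qed.

Lemma ddef_lt t u : tdef t -> tdef u -> ddef (fun e => lt (t e) (u e)).
Proof.
  intros H1 H2. ddef_atom H1 H2 c d u1 E1 u2 E2.
  exists (Lt u1 u2); split; [constructor|]. intros e. simpl. now rewrite E1, E2.
Qed.

Lemma ddef_mem t X : tdef t -> ddef (fun e => mem (t e) X).
Proof.
  intros [l [k H]]. exists l, [X], k. intros c s Hc Hs d Hd.
  destruct (H c Hc d Hd) as [u E]. destruct (Hs X) as [i Hi]; [now left|].
  exists (Mem u i); split; [constructor|]. intros e. simpl. now rewrite E, Hi.
Qed.

Lemma ddef_False : ddef (fun _ => False).
Proof.
  exists [], [], 0. intros. exists Bot. split; [constructor|]. simpl; tauto.
Qed.

Lemma ddef_imp P Q : ddef P -> ddef Q -> ddef (fun e => P e -> Q e).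
Proof.
  intros [l [ls [k H]]] [l' [ls' [k' H']]].
  exists (l ++ l'), (ls ++ ls'), (Nat.max k k').
  intros c s Hc Hs d Hd. apply lists_app in Hc as [? ?], Hs as [? ?].
  destruct (H c s) with d as [p [Hp E]]; auto; [lia|].
  destruct (H' c s) with d as [q [Hq E']]; auto; [lia|].
  exists (Imp p q); split; [now constructor|]. intros e. simpl. now rewrite E, E'.
Qed.

Lemma ddef_not P : ddef P -> ddef (fun e => ~ P e).
Proof. intros H. apply ddef_imp; auto using ddef_False. Qed.

Lemma ddef_and P Q : ddef P -> ddef Q -> ddef (fun e => P e /\ Q e).
Proof.
  intros HP HQ. apply (ddef_iff (fun e => ~ (P e -> ~ Q e))).
  - intros; tauto.
  - apply ddef_not, ddef_imp, ddef_not; auto.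
Qed.

Lemma ddef_or P Q : ddef P -> ddef Q -> ddef (fun e => P e \/ Q e).
Proof.
  intros HP HQ. apply (ddef_iff (fun e => ~ P e -> Q e)).
  - intros; tauto.
  - apply ddef_imp; auto using ddef_not.
Qed.

Lemma ddef_allB t (P : N -> env -> Prop) :
  tdef t -> ddef (fun e => P (e 0) (fun n => e (S n))) ->
  ddef (fun e => forall x, lt x (t e) -> P x e).
Proof.
  intros [l [k H]] [l' [ls [k' H']]].
  exists (l ++ l'), ls, (Nat.max k k').
  intros c s Hc Hs d Hd. apply lists_app in Hc as [? ?].
  destruct (H c) with d as [u E]; auto; [lia|].
  destruct (H' c s) with (S d) as [p [Hp E']]; auto; [lia|].
  exists (AllB u p); split; [now constructor|]. intros e.
  rewrite sat_AllB, E. split; intros HH x Hx; specialize (HH x Hx).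
  - rewrite scons_mix, E' in HH. exact HH.
  - rewrite scons_mix, E'. exact HH.
Qed.

Lemma ddef_exB t (P : N -> env -> Prop) :
  tdef t -> ddef (fun e => P (e 0) (fun n => e (S n))) ->
  ddef (fun e => exists x, lt x (t e) /\ P x e).
Proof.
  intros Ht HP.
  apply (ddef_iff (fun e => ~ forall x, lt x (t e) -> ~ P x e)).
  - intros e; split.
    + intros H. apply NNPP; intros Hn. apply H. intros x Hx HPx.
      apply Hn. now exists x.
    + intros [x [Hx HPx]] H. now apply (H x Hx).
  - apply ddef_not, ddef_allB, ddef_not; auto.
Qed.

Lemma ddef_equiv P Q : ddef P -> ddef Q -> ddef (fun e => P e <-> Q e).
Proof. intros; apply ddef_and; apply ddef_imp; auto. Qed.

(** The Sigma^0_1 predicates with parameters. *)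
Definition sdef (P : env -> Prop) : Prop :=
  exists Q : N -> env -> Prop,
    ddef (fun e => Q (e 0) (fun n => e (S n))) /\
    forall e, P e <-> exists w, Q w e.

Lemma sdef_ddef P : ddef P -> sdef P.
Proof.
  intros H. exists (fun _ => P). split; [now apply ddef_shift|].
  intros e; split; [now exists zero | now intros [_ ?]].
Qed.

Lemma sdef_iff P Q : (forall e, P e <-> Q e) -> sdef P -> sdef Q.
Proof.
  intros H [R [HR E]]. exists R; split; auto. intros e. now rewrite <- H.
Qed.

Lemma sdef_subst P (f : nat -> env -> N) :
  sdef P -> (forall n, tdef (f n)) -> sdef (fun e => P (fun n => f n e)).
Proof.
  intros [Q [HQ E]] Hf. exists (fun w e => Q w (fun n => f n e)). split.
  - apply (ddef_subst _ (fun n => match n with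
      | 0 => fun e => e 0 | S n => fun e => f n (fun n => e (S n)) end) HQ).
    intros [|n]; [apply tdef_var|].
    apply (tdef_subst (f n) (fun n e => e (S n))); auto using tdef_var.
  - intros e. apply E.
Qed.

End Definability.

Arguments tdef {M}.
Arguments ddef {M}.
Arguments sdef {M}.

(** Below bounded quantifiers a term is read in a shifted environment; the patterns handle up to
    five shifts. *)
Ltac tdef_step :=
  first
  [ assumption
  | apply tdef_const
  | apply tdef_var
  | apply tdef_add
  | apply tdef_mul
  | match goal with
    | |- tdef (fun e => ?t (fun n => e (S n))) =>
        apply (tdef_subst _ t (fun n e => e (S n)))
    | |- tdef (fun e => ?t (fun n => e (S (S n)))) =>
        apply (tdef_subst _ t (fun n e => e (S (S n))))
    | |- tdef (fun e => ?t (fun n => e (S (S (S n))))) =>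
        apply (tdef_subst _ t (fun n e => e (S (S (S n)))))
    | |- tdef (fun e => ?t (fun n => e (S (S (S (S n)))))) =>
        apply (tdef_subst _ t (fun n e => e (S (S (S (S n))))))
    | |- tdef (fun e => ?t (fun n => e (S (S (S (S (S n))))))) =>
        apply (tdef_subst _ t (fun n e => e (S (S (S (S (S n)))))))
    end
  | intros ? ].

(** A hook, redefined whenever further predicates have to be unfolded. *)
Ltac ddef_extra := fail.
Ltac definable_step :=
  cbv beta;
  match goal with
  | |- ddef _ =>
    first
    [ ddef_extra
    | assumption
    | match goal with H : _ |- _ => apply H end
    | apply ddef_eq
    | apply ddef_lt
    | apply ddef_mem
    | apply ddef_not
    | apply ddef_allB
    | apply ddef_exB
    | apply ddef_imp
    | apply ddef_and
    | apply ddef_or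
    | apply ddef_equiv ]
  | |- _ => tdef_step
  end.
Ltac definable := repeat definable_step.

(** * Arithmetic *)

Declare Scope model_scope.

Section Arithmetic.

Variable M : structure.
Hypothesis M_RCA0 : forall p, RCA0 p -> valid M p.
(** A default value for set variables, needed to write down environments. *)
Variable X0 : sets M.

Notation N := (num M).
Notation env := (nat -> N).
Infix "+" := (@add M) : model_scope.
Infix "*" := (@mul M) : model_scope.
Infix "<" := (@lt M) : model_scope.
Open Scope model_scope.

Lemma sigma1_induction (P : N -> Prop) :
  sdef (fun e => P (e 0)) ->
  P zero -> (forall x, P x -> P (x + one)) -> forall x, P x.
Proof.
  intros [Q [[l [ls [k H]]] E]] H0 HS.
  set (c := fun i => nth i l zero). set (s := fun i => nth i ls X0).
  (* As [d] is positive, the induction variable has a place among the first [d] indices; [S d] adds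
     the place of the witness. *)
  set (d := Nat.max k 1).
  destruct (H c s (lists_nth _ _) (lists_nth _ _) (S d)) as [p [Hp Ep]]; [lia|].
  set (c' := mix M (pred d) (fun _ => zero) c).
  assert (Es : forall x, sat (x .: c') s (ExN p) <-> P x).
  { intros x. rewrite sat_ExN. rewrite (E (x .: fun _ => zero)).
    unfold c'. rewrite scons_mix. replace (S (pred d)) with d by lia.
    split; intros [w Hw]; exists w.
    - rewrite scons_mix in Hw. now apply Ep in Hw.
    - rewrite scons_mix. now apply Ep. }
  assert (Hi := M_RCA0 _ (rca_induction _ (Sigma01_intro _ Hp)) c' s).
  change (sat c' s (instN Zero (ExN p) ∧ AllN (ExN p ⇒ at_succ (ExN p))) ->
          forall x, sat (x .: c') s (ExN p)) in Hi.
  intros x. apply Es, Hi, sat_And. split.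
  - apply sat_subst.
    replace (fun n => _) with (zero .: c'); [now apply Es|].
    apply functional_extensionality; intros [|n]; reflexivity.
  - intros y Hy. apply sat_subst.
    replace (fun n => _) with (y + one .: c'); [now apply Es, HS, Es|].
    apply functional_extensionality; intros [|n]; reflexivity.
Qed.

Lemma delta0_induction (P : N -> Prop) :
  ddef (fun e => P (e 0)) ->
  P zero -> (forall x, P x -> P (x + one)) -> forall x, P x.
Proof. intros H. apply sigma1_induction, sdef_ddef, H. Qed.

Lemma delta1_comprehension (P : N -> Prop) :
  sdef (fun e => P (e 0)) -> sdef (fun e => ~ P (e 0)) ->
  exists X, forall x, mem x X <-> P x.
Proof.
  intros [Q1 [[l1 [ls1 [k1 H1]]] E1]] [Q2 [[l2 [ls2 [k2 H2]]] E2]].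
  (* The axiom reads both formulas in one environment, so they share their constants. *)
  set (c := fun i => nth i (l1 ++ l2) zero). set (s := fun i => nth i (ls1 ++ ls2) X0).
  destruct (proj1 (lists_app c l1 l2) (lists_nth _ _)) as [Hc1 Hc2].
  destruct (proj1 (lists_app s ls1 ls2) (lists_nth _ _)) as [Hs1 Hs2].
  set (d := Nat.max 1 (Nat.max k1 k2)).
  destruct (H1 c s Hc1 Hs1 (S d)) as [p [Hp Ep]]; [lia|].
  destruct (H2 c s Hc2 Hs2 (S d)) as [q [Hq Eq]]; [lia|].
  set (c' := mix M (pred d) (fun _ => zero) c).
  assert (Ec : forall w x, w .: x .: c' = mix M (S d) (w .: x .: fun _ => zero) c).
  { intros w x. unfold c'. rewrite !scons_mix. now replace (S (pred d)) with d by lia. }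
  assert (Esp : forall x, sat (x .: c') s (ExN p) <-> P x).
  { intros x. rewrite sat_ExN, (E1 (x .: fun _ => zero)).
    split; intros [w Hw]; exists w.
    - rewrite Ec in Hw. now apply Ep in Hw.
    - rewrite Ec. now apply Ep. }
  (* The Sigma^0_1 form of the complement, negated, is the Pi^0_1 form that the axiom asks for. *)
  assert (Esq : forall x, sat (x .: c') s (AllN (Not q)) <-> P x).
  { intros x. pose proof (E2 (x .: fun _ => zero)) as E. simpl in E.
    transitivity (~ exists w, Q2 w (x .: fun _ => zero)); [|rewrite <- E; tauto].
    split.
    - intros Hn [w Hw]. apply (Hn w). rewrite Ec. now apply Eq.
    - intros Hn w Hw. apply Hn. exists w. rewrite Ec in Hw. now apply Eq in Hw. }
  pose proof (M_RCA0 _ (rca_comprehension _ _ (Sigma01_intro _ Hp)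
    (Pi01_intro (Not q) (dImp _ _ Hq dBot))) c' s) as H.
  change (sat c' s (AllN (ExN p ⇔ AllN (Not q))) ->
          sat c' s (ExS (AllN (#0 ∈ 0 ⇔ liftS (ExN p))))) in H.
  rewrite sat_ExS in H. destruct H as [X HX].
  - intros x. now rewrite sat_Iff, Esp, Esq.
  - exists X. intros x. specialize (HX x). rewrite sat_Iff in HX.
    rewrite <- Esp. etransitivity; [exact HX|].
    exact (sat_subst M (ExN p) (x .: c') (X .: s) Var S).
Qed.

Lemma add_0_r x : x + zero = x.
Proof. exact (M_RCA0 _ (rca_basic _ ax_add0) (fun _ => x) (fun _ => X0)). Qed.

Lemma add_succ_r x y : x + (y + one) = (x + y) + one.
Proof. exact (M_RCA0 _ (rca_basic _ ax_addS) (x .: fun _ => y) (fun _ => X0)). Qed.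

Lemma mul_0_r x : x * zero = zero.
Proof. exact (M_RCA0 _ (rca_basic _ ax_mul0) (fun _ => x) (fun _ => X0)). Qed.

Lemma mul_succ_r x y : x * (y + one) = x * y + x.
Proof. exact (M_RCA0 _ (rca_basic _ ax_mulS) (x .: fun _ => y) (fun _ => X0)). Qed.

Lemma succ_neq_0 x : x + one <> zero.
Proof. exact (M_RCA0 _ (rca_basic _ ax_succ_ne0) (fun _ => x) (fun _ => X0)). Qed.

Lemma succ_inj x y : x + one = y + one -> x = y.
Proof. exact (M_RCA0 _ (rca_basic _ ax_succ_inj) (x .: fun _ => y) (fun _ => X0)). Qed.

Lemma lt_0_r x : ~ x < zero.
Proof. exact (M_RCA0 _ (rca_basic _ ax_lt0) (fun _ => x) (fun _ => X0)). Qed.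

Lemma lt_succ_or x y : x < y + one <-> x < y \/ x = y.
Proof.
  pose proof (M_RCA0 _ (rca_basic _ ax_ltS) (x .: fun _ => y) (fun _ => X0)) as H.
  rewrite sat_Iff, sat_Or in H. exact H.
Qed.

Lemma add_assoc x y z : x + (y + z) = (x + y) + z.
Proof.
  revert z. apply delta0_induction.
  - definable.
  - now rewrite !add_0_r.
  - intros z IH. now rewrite !add_succ_r, IH.
Qed.

Lemma add_0_l x : zero + x = x.
Proof.
  revert x. apply delta0_induction.
  - definable.
  - apply add_0_r.
  - intros x IH. now rewrite add_succ_r, IH.
Qed.

Lemma add_succ_l x y : (x + one) + y = (x + y) + one.
Proof.
  revert y. apply delta0_induction.
  - definable.
  - now rewrite !add_0_r.
  - intros y IH. now rewrite !add_succ_r, IH.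
Qed.

Lemma add_comm x y : x + y = y + x.
Proof.
  revert y. apply delta0_induction.
  - definable.
  - now rewrite add_0_r, add_0_l.
  - intros y IH. now rewrite add_succ_r, add_succ_l, IH.
Qed.

Lemma mul_add_distr_l x y z : x * (y + z) = x * y + x * z.
Proof.
  revert z. apply delta0_induction.
  - definable.
  - now rewrite mul_0_r, !add_0_r.
  - intros z IH. now rewrite add_succ_r, !mul_succ_r, IH, add_assoc.
Qed.

Lemma mul_assoc x y z : x * (y * z) = (x * y) * z.
Proof.
  revert z. apply delta0_induction.
  - definable.
  - now rewrite !mul_0_r.
  - intros z IH. now rewrite !mul_succ_r, mul_add_distr_l, IH.
Qed.

Lemma mul_0_l x : zero * x = zero.
Proof.
  revert x. apply delta0_induction.
  - definable.
  - apply mul_0_r.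
  - intros x IH. now rewrite mul_succ_r, IH, add_0_r.
Qed.

Lemma mul_succ_l x y : (x + one) * y = x * y + y.
Proof.
  revert y. apply delta0_induction.
  - definable.
  - now rewrite !mul_0_r, add_0_r.
  - intros y IH.
    rewrite !mul_succ_r, IH, <- !add_assoc. f_equal.
    now rewrite !add_assoc, (add_comm x y).
Qed.

Lemma mul_comm x y : x * y = y * x.
Proof.
  revert y. apply delta0_induction.
  - definable.
  - now rewrite mul_0_r, mul_0_l.
  - intros y IH. now rewrite mul_succ_r, mul_succ_l, IH.
Qed.

Lemma mul_1_l x : one * x = x.
Proof. rewrite <- (add_0_l one), mul_succ_l, mul_0_l. apply add_0_l. Qed.

Lemma mul_add_distr_r x y z : (x + y) * z = x * z + y * z.
Proof. now rewrite mul_comm, mul_add_distr_l, (mul_comm z x), (mul_comm z y). Qed.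

Lemma model_semiring : semi_ring_theory zero one (@add M) (@mul M) eq.
Proof.
  constructor; auto using add_0_l, add_comm, add_assoc, mul_1_l, mul_0_l,
    mul_comm, mul_assoc, mul_add_distr_r.
Qed.

Add Ring model_ring : model_semiring.

Lemma add_cancel_r x y z : x + z = y + z -> x = y.
Proof.
  revert z. apply (delta0_induction (fun z => _ -> _)).
  - definable.
  - now rewrite !add_0_r.
  - intros z IH H. rewrite !add_succ_r in H. now apply IH, succ_inj.
Qed.

Lemma add_cancel_l x y z : z + x = z + y -> x = y.
Proof. rewrite !(add_comm z). apply add_cancel_r. Qed.

Lemma zero_or_succ x : x = zero \/ exists y, x = y + one.
Proof.
  (* With a bound on the predecessor the statement is Delta^0_0. *)
  enough (H : x = zero \/ exists y, y < x /\ x = y + one) by firstorder.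
  revert x. apply delta0_induction.
  - definable.
  - now left.
  - intros x _. right. exists x. split; auto. apply lt_succ_or; auto.
Qed.

Lemma add_eq_0 x y : x + y = zero -> x = zero /\ y = zero.
Proof.
  intros H. destruct (zero_or_succ y) as [->|[z ->]].
  - now rewrite add_0_r in H.
  - rewrite add_succ_r in H. now apply succ_neq_0 in H.
Qed.

Lemma lt_add x z : x < x + z + one.
Proof.
  revert z. apply delta0_induction.
  - definable.
  - rewrite add_0_r. apply lt_succ_or; auto.
  - intros z IH. rewrite add_succ_r. apply lt_succ_or; auto.
Qed.

(** Together with [le_exists], this reduces facts about the order to semiring identities, which
    [ring] proves. *)
Lemma lt_exists x y : x < y <-> exists z, y = x + z + one.
Proof.
  split; [|intros [z ->]; apply lt_add].
  revert y. apply (sigma1_induction (fun y => _ -> _)).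
  (* The quantifier is pulled in front of the implication; if the premise fails, any witness will
     do. *)
  - exists (fun z e => x < e 0 -> e 0 = x + z + one). split; [definable|].
    intros e. split; [|intros [z Hz] H; exists z; auto].
    intros H. destruct (classic (x < e 0)) as [Hx|Hx].
    + destruct (H Hx) as [z Hz]. now exists z.
    + now exists zero.
  - intros H. now apply lt_0_r in H.
  - intros y IH H. apply lt_succ_or in H as [H| ->].
    + destruct (IH H) as [z ->]. exists (z + one). ring.
    + exists zero. ring.
Qed.

Definition le (x y : N) : Prop := x < y \/ x = y.
Infix "<=" := le : model_scope.

Lemma le_exists x y : x <= y <-> exists z, y = x + z.
Proof.
  split.
  - intros [H| ->].
    + apply lt_exists in H as [z ->]. exists (z + one). ring.
    + exists zero. ring.
  - intros [z ->]. destruct (zero_or_succ z) as [->|[w ->]].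
    + right. ring.
    + left. apply lt_exists. exists w. ring.
Qed.

Lemma lt_succ_r x y : x < y + one <-> x <= y.
Proof. apply lt_succ_or. Qed.

Lemma le_succ_l x y : x + one <= y <-> x < y.
Proof.
  rewrite le_exists, lt_exists. split; intros [z ->]; exists z; ring.
Qed.

Lemma le_refl x : x <= x.
Proof. now right. Qed.

Lemma lt_le x y : x < y -> x <= y.
Proof. now left. Qed.

Lemma le_lt_trans x y z : x <= y -> y < z -> x < z.
Proof.
  rewrite le_exists, !lt_exists. intros [u ->] [v ->]. exists (u + v). ring.
Qed.

Lemma lt_le_trans x y z : x < y -> y <= z -> x < z.
Proof.
  rewrite le_exists, !lt_exists. intros [u ->] [v ->]. exists (u + v). ring.
Qed.

Lemma le_trans x y z : x <= y -> y <= z -> x <= z.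
Proof.
  rewrite !le_exists. intros [u ->] [v ->]. exists (u + v). ring.
Qed.

Lemma lt_irrefl x : ~ x < x.
Proof.
  rewrite lt_exists. intros [z H]. apply (succ_neq_0 z).
  apply (add_cancel_l _ _ x). rewrite add_0_r, add_assoc. auto.
Qed.

Lemma le_or_lt x y : x <= y \/ y < x.
Proof.
  revert x. apply delta0_induction.
  - unfold le. definable.
  - left. apply le_exists. exists y. ring.
  - intros x [[H| ->]|H].
    + left. now apply le_succ_l.
    + right. apply lt_succ_r, le_refl.
    + right. apply lt_succ_r, lt_le, H.
Qed.

Lemma not_lt x y : ~ x < y <-> y <= x.
Proof.
  split.
  - destruct (le_or_lt y x); tauto.
  - intros H1 H2. apply (lt_irrefl y). now apply le_lt_trans with x.
Qed.

Lemma lt_trichotomy x y : x < y \/ x = y \/ y < x.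
Proof. destruct (le_or_lt x y) as [[|]|]; auto. Qed.

Lemma le_add_l x y : x <= y + x.
Proof. apply le_exists. exists y. ring. Qed.

Lemma le_add_r x y : x <= x + y.
Proof. apply le_exists. now exists y. Qed.

Lemma lt_succ_diag x : x < x + one.
Proof. apply lt_succ_r, le_refl. Qed.

Lemma lt_0_succ x : zero < x + one.
Proof. apply lt_exists. exists x. ring. Qed.

Lemma lt_0_iff x : zero < x <-> x <> zero.
Proof.
  split.
  - intros H ->. now apply lt_irrefl in H.
  - intros H. destruct (zero_or_succ x) as [|[y ->]]; [easy|apply lt_0_succ].
Qed.

Lemma add_lt_cancel_l x y z : z + x < z + y <-> x < y.
Proof.
  rewrite !lt_exists. split; intros [w H].
  - exists w. apply (add_cancel_l _ _ z). rewrite H. ring.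
  - exists w. rewrite H. ring.
Qed.

Lemma mul_le_l x y : zero < y -> x <= x * y.
Proof.
  intros H. destruct (zero_or_succ y) as [->|[z ->]]; [now apply lt_irrefl in H|].
  apply le_exists. exists (x * z). ring.
Qed.

Lemma mul_pos x y : zero < x -> zero < y -> zero < x * y.
Proof. intros Hx Hy. apply lt_le_trans with x; auto using mul_le_l. Qed.

Ltac ddef_extra ::= progress unfold le.

(** * Closure properties of Sigma^0_1 predicates *)

(** A common bound [u] for both witnesses contracts the two unbounded quantifiers into one. *)
Lemma sdef_ex (P : N -> env -> Prop) :
  sdef (fun e => P (e 0) (fun n => e (S n))) -> sdef (fun e => exists x, P x e).
Proof.
  intros [Q [HQ E]].
  exists (fun u e => exists x, x < u /\ exists w, w < u /\ Q w (x .: e)). split.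
  - apply ddef_exB; [apply tdef_var|]. cbv beta. apply ddef_exB; [apply tdef_var|].
    (* Entries 0, 1 and 2 are [w], [x] and the bound [u]; the matrix skips the last. *)
    refine (ddef_subst _ _ (fun n e => match n with
      | 0 => e 0 | 1 => e 1 | S (S n) => e (3 + n)%nat end) HQ _).
    intros [|[|n]]; apply tdef_var.
  - intros e. split.
    + intros [x Hx]. apply (E (x .: e)) in Hx as [w Hw].
      exists (x + w + one). exists x. split; [apply lt_succ_r, le_add_r|].
      exists w. split; auto. apply lt_succ_r, le_add_l.
    + intros [u [x [_ [w [_ Hw]]]]]. exists x. apply (E (x .: e)). now exists w.
Qed.

Lemma sdef_and P Q : sdef P -> sdef Q -> @sdef M (fun e => P e /\ Q e).
Proof.
  intros [P' [HP EP]] [Q' [HQ EQ]].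
  apply (sdef_iff _ (fun e => exists v w, P' v e /\ Q' w e)).
  { intros e. rewrite EP, EQ. firstorder. }
  apply sdef_ex, sdef_ex, sdef_ddef, ddef_and.
  - refine (ddef_subst _ _ (fun n e => match n with
      | 0 => e 1 | S n => e (2 + n)%nat end) HP _).
    intros [|n]; apply tdef_var.
  - refine (ddef_subst _ _ (fun n e => match n with
      | 0 => e 0 | S n => e (2 + n)%nat end) HQ _).
    intros [|n]; apply tdef_var.
Qed.

Lemma sdef_or P Q : sdef P -> sdef Q -> @sdef M (fun e => P e \/ Q e).
Proof.
  intros [P' [HP EP]] [Q' [HQ EQ]].
  exists (fun w e => P' w e \/ Q' w e). split; [now apply ddef_or|].
  intros e. rewrite EP, EQ. firstorder.
Qed.

Lemma sdef_imp P Q : ddef P -> sdef Q -> @sdef M (fun e => P e -> Q e).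
Proof.
  intros HP HQ. apply (sdef_iff _ (fun e => ~ P e \/ Q e)).
  - intros e. tauto.
  - apply sdef_or; auto. apply sdef_ddef, ddef_not, HP.
Qed.

Lemma sdef_exB t (P : N -> env -> Prop) :
  tdef t -> sdef (fun e => P (e 0) (fun n => e (S n))) ->
  sdef (fun e => exists x, x < t e /\ P x e).
Proof.
  intros Ht HP. apply sdef_ex, sdef_and; auto.
  apply sdef_ddef. definable.
Qed.

(** This is Sigma^0_1 collection, proved by induction on the bound. *)
Lemma sdef_allB t (P : N -> env -> Prop) :
  tdef t -> sdef (fun e => P (e 0) (fun n => e (S n))) ->
  sdef (fun e => forall x, x < t e -> P x e).
Proof.
  intros Ht [Q [HQ E]].
  exists (fun u e => forall x, x < t e -> exists w, w < u /\ Q w (x .: e)). split.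
  - apply ddef_allB; [definable|]. cbv beta. apply ddef_exB; [apply tdef_var|].
    refine (ddef_subst _ _ (fun n e => match n with
      | 0 => e 0 | 1 => e 1 | S (S n) => e (3 + n)%nat end) HQ _).
    intros [|[|n]]; apply tdef_var.
  - intros e. split.
    + intros H.
      enough (Hy : forall y, y <= t e ->
        exists u, forall x, x < y -> exists w, w < u /\ Q w (x .: e)).
      { apply Hy, le_refl. }
      apply (sigma1_induction (fun y => y <= t e ->
        exists u, forall x, x < y -> exists w, w < u /\ Q w (x .: e))).
      * apply sdef_imp; [definable|]. apply sdef_ex, sdef_ddef, ddef_allB; [definable|].
        cbv beta. apply ddef_exB; [apply tdef_var|].
        refine (ddef_subst _ _ (fun n e' => match n with
          | 0 => e' 0 | 1 => e' 1 | S (S n) => e n end) HQ _).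
        intros [|[|n]]; definable.
      * intros _. exists zero. intros x Hx. now apply lt_0_r in Hx.
      * intros y IH Hy. apply le_succ_l in Hy.
        destruct IH as [u Hu]; [now apply lt_le|].
        specialize (H y Hy). apply (E (y .: e)) in H as [v Hv].
        exists (u + v + one). intros x Hx. apply lt_succ_r in Hx as [Hx| ->].
        -- destruct (Hu x Hx) as [w [Hw Hw']]. exists w. split; auto.
           apply lt_succ_r, lt_le. apply lt_le_trans with u; auto using le_add_r.
        -- exists v. split; auto. apply lt_succ_r, le_add_l.
    + intros [u Hu] x Hx. destruct (Hu x Hx) as [w [_ Hw]].
      apply (E (x .: e)). now exists w.
Qed.

(** Without a least element one can descend from [a] by any amount [x], and this is a Sigma^0_1
    statement about [x]. Descending by [a + 1] is absurd. *)
Lemma sigma1_least (P : N -> Prop) a :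
  sdef (fun e => P (e 0)) -> P a -> exists x, P x /\ forall y, y < x -> ~ P y.
Proof.
  intros HP Ha. apply NNPP; intros Hn.
  assert (H : forall x, exists y, y + x <= a /\ P y).
  { apply sigma1_induction.
    - apply sdef_ex, sdef_and; [apply sdef_ddef; definable|].
      apply (sdef_subst _ _ (fun _ e => e 0) HP). intros; apply tdef_var.
    - exists a. split; auto. rewrite add_0_r. apply le_refl.
    - intros x [y [Hyx Hy]].
      assert (exists z, z < y /\ P z) as [z [Hz Pz]].
      { apply NNPP; intros H. apply Hn. exists y. split; auto.
        intros z Hz Pz. apply H. now exists z. }
      exists z. split; auto. apply le_trans with (y + x); auto.
      apply lt_exists in Hz as [w ->]. apply le_exists. exists w. ring. }
  destruct (H (a + one)) as [y [Hy _]]. apply not_lt in Hy. apply Hy.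
  apply le_lt_trans with (y + a); [apply le_add_l|].
  rewrite add_assoc. apply lt_succ_diag.
Qed.

(** That nothing below [x] satisfies [P] is Sigma^0_1 by collection, so it can be proved by
    induction on [x]. *)
Lemma pi1_least (P : N -> Prop) a :
  sdef (fun e => ~ P (e 0)) -> P a -> exists x, P x /\ forall y, y < x -> ~ P y.
Proof.
  intros HP Ha. apply NNPP; intros Hn.
  assert (H : forall x y, y < x -> ~ P y).
  { apply (sigma1_induction (fun x => forall y, y < x -> ~ P y)).
    - apply sdef_allB; [definable|].
      apply (sdef_subst _ _ (fun _ e => e 0) HP). intros; apply tdef_var.
    - intros y Hy. now apply lt_0_r in Hy.
    - intros x IH y Hy Py. apply lt_succ_r in Hy as [Hy| ->]; [now apply (IH y)|].
      apply Hn. now exists x. }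
  apply (H (a + one) a); auto using lt_succ_diag.
Qed.

(** The bound on the quotient makes divisibility Delta^0_0. *)
Definition dvd (d x : N) : Prop := exists q, q < x + one /\ x = q * d.

Definition modulus (b i : N) : N := (i + one) * b + one.

Definition entry (a b i z : N) : Prop :=
  z < modulus b i /\ exists q, q < a + one /\ a = q * modulus b i + z.

Ltac ddef_extra ::= progress unfold le, dvd, modulus, entry.
Ltac sdefinable_step :=
  cbv beta;
  lazymatch goal with
  | |- sdef _ =>
    first
    [ assumption
    | match goal with H : _ |- _ => apply H end
    | solve [apply sdef_ddef; definable]
    | apply sdef_allB
    | apply sdef_exB
    | apply sdef_ex
    | apply sdef_and
    | apply sdef_or
    | apply sdef_imp ]
  | |- _ => definable_step
  end.
Ltac sdefinable := repeat sdefinable_step.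

(** * Congruences and the beta function *)

(** Both sides receive a multiple of [m] because there is no subtraction. *)
Definition cong (m x y : N) : Prop := exists v w, x + w * m = y + v * m.

Lemma cong_refl m x : cong m x x.
Proof. now exists zero, zero. Qed.

Lemma cong_sym m x y : cong m x y -> cong m y x.
Proof. intros [v [w H]]. now exists w, v. Qed.

Lemma cong_trans m x y z : cong m x y -> cong m y z -> cong m x z.
Proof.
  intros [v [w H]] [v' [w' H']]. exists (v + v'), (w + w').
  transitivity ((x + w * m) + w' * m); [ring|]. rewrite H.
  transitivity ((y + w' * m) + v * m); [ring|]. rewrite H'. ring.
Qed.

Lemma cong_mul_r m x y z : cong m x y -> cong m (x * z) (y * z).
Proof.
  intros [v [w H]]. exists (v * z), (w * z).
  transitivity ((x + w * m) * z); [ring|]. rewrite H. ring.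
Qed.

Lemma cong_add_l m x y z : cong m x y -> cong m (z + x) (z + y).
Proof.
  intros [v [w H]]. exists v, w.
  transitivity (z + (x + w * m)); [ring|]. rewrite H. ring.
Qed.

Lemma cong_add_mul m x v : cong m (x + v * m) x.
Proof. exists v, zero. ring. Qed.

Definition invertible (m x : N) : Prop := exists u, cong m (x * u) one.

Lemma invertible_cong m x y : cong m x y -> invertible m x -> invertible m y.
Proof.
  intros H [u Hu]. exists u. apply cong_trans with (x * u); auto.
  apply cong_mul_r, cong_sym, H.
Qed.

Lemma invertible_mul m x y : invertible m x -> invertible m y -> invertible m (x * y).
Proof.
  intros [u Hu] [v Hv]. exists (u * v).
  apply cong_trans with (one * (y * v)).
  - replace (x * y * (u * v)) with (x * u * (y * v)) by ring. now apply cong_mul_r.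
  - now rewrite mul_1_l.
Qed.

Lemma invertible_factor m x y : invertible m (x * y) -> invertible m x.
Proof. intros [u Hu]. exists (y * u). now rewrite mul_assoc. Qed.

(** Here [x] is -1 modulo [m], hence its own inverse. *)
Lemma invertible_pred m x : m = x + one -> invertible m x.
Proof. intros ->. exists x, x, one. ring. Qed.

Lemma dvd_intro d x q : x = q * d -> dvd d x.
Proof.
  intros ->. destruct (zero_or_succ d) as [->|[k ->]].
  - exists zero. split; [|ring]. replace (q * zero) with (@zero M) by ring.
    apply lt_succ_diag.
  - exists q. split; auto. apply lt_succ_r, mul_le_l, lt_0_succ.
Qed.

Lemma dvd_cong_0 m x : cong m x zero -> dvd m x.
Proof.
  intros [v [w H]]. rewrite add_0_l in H.
  destruct (le_or_lt w v) as [L|L].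
  - apply le_exists in L as [z ->]. apply dvd_intro with z.
    apply (add_cancel_r _ _ (w * m)). rewrite H. ring.
  - apply lt_exists in L as [z ->].
    assert (E : x + (z + one) * m = zero).
    { apply (add_cancel_r _ _ (v * m)). rewrite add_0_l.
      etransitivity; [|exact H]. ring. }
    apply add_eq_0 in E as [-> _]. apply dvd_intro with zero. ring.
Qed.

(** With [u] inverse to [x], the number [y] is congruent to [x u y], a multiple of [m]. *)
Lemma dvd_mul_invertible m x y : invertible m x -> dvd m (x * y) -> dvd m y.
Proof.
  intros [u Hu] [q [_ Hq]]. apply dvd_cong_0.
  apply cong_trans with ((x * u) * y).
  - apply cong_sym. rewrite <- (mul_1_l y) at 2. now apply cong_mul_r.
  - replace (x * u * y) with (zero + (u * q) * m); [apply cong_add_mul|].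
    transitivity (u * (q * m)); [ring|]. rewrite <- Hq. ring.
Qed.

Lemma dvd_refl x : dvd x x.
Proof. apply dvd_intro with one. ring. Qed.

Lemma dvd_mul_r d x y : dvd d x -> dvd d (x * y).
Proof. intros [q [_ ->]]. apply dvd_intro with (q * y). ring. Qed.

Lemma dvd_mul_l d x y : dvd d y -> dvd d (x * y).
Proof. rewrite mul_comm. apply dvd_mul_r. Qed.

(** Plays the role of the factorial in the usual choice of [b] for the beta function. *)
Definition common_multiple (n b : N) : Prop := forall i, i < n -> dvd (i + one) b.

(** The lower bound [B] serves to make every modulus larger than the values to be coded. *)
Lemma common_multiple_exists n B : exists b, B <= b /\ common_multiple n b.
Proof.
  unfold common_multiple. revert n. apply sigma1_induction.
  - sdefinable.
  - exists B. split; [apply le_refl|]. intros i Hi. now apply lt_0_r in Hi.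
  - intros n [b [Hb H]]. exists (b * (n + one)). split.
    + apply le_trans with b; auto. apply mul_le_l, lt_0_succ.
    + intros i Hi. apply lt_succ_r in Hi as [Hi| ->].
      * now apply dvd_mul_r, H.
      * apply dvd_mul_l, dvd_refl.
Qed.

Lemma invertible_modulus_base b j : invertible (modulus b j) ((j + one) * b).
Proof. now apply invertible_pred. Qed.

(** Both factors divide something invertible: [b] divides [(j + 1) b], and so does [k + 1], since it
    divides [b]. *)
Lemma invertible_diff n b j k :
  common_multiple n b -> k < n -> invertible (modulus b j) ((k + one) * b).
Proof.
  intros H Hk. apply invertible_mul.
  - destruct (H k Hk) as [q [_ E]].
    apply invertible_factor with (q * (j + one)).
    replace ((k + one) * (q * (j + one))) with ((j + one) * (q * (k + one))) by ring.
    rewrite <- E. apply invertible_modulus_base.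
  - apply invertible_factor with (j + one). rewrite mul_comm.
    apply invertible_modulus_base.
Qed.

(** Modulo [m_j], where [(j+1)b] is [-1], the modulus [m_i] is [(i-j)b]. *)
Lemma invertible_modulus n b i j :
  common_multiple n b -> i <= n -> j <= n -> i <> j ->
  invertible (modulus b j) (modulus b i).
Proof.
  intros H Hi Hj Hij. destruct (lt_trichotomy i j) as [L|[L|L]]; [|easy|].
  - apply lt_exists in L as [k ->].
    (* For [i < j] the difference [i - j] is negative; the extra factor [(j + 1) b] supplies the
       sign. *)
    apply invertible_cong with ((k + one) * b * ((i + k + one + one) * b)).
    + apply cong_sym. exists one, ((k + one) * b). unfold modulus. ring.
    + apply invertible_mul; [|apply invertible_modulus_base].
      apply invertible_diff with n; auto. apply le_succ_l.
      apply le_trans with (i + k + one); auto. apply le_exists. exists i. ring.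
  - apply lt_exists in L as [k ->].
    apply invertible_cong with ((k + one) * b).
    + exists zero, one. unfold modulus. ring.
    + apply invertible_diff with n; auto. apply le_succ_l.
      apply le_trans with (j + k + one); auto. apply le_exists. exists j. ring.
Qed.

(** The witness is the product of the first [k] moduli. No term denotes it, so the induction carries
    its properties along. *)
Lemma moduli_multiple n b k :
  common_multiple n b -> k <= n ->
  exists c, zero < c /\ invertible (modulus b k) c /\
    forall i, i < k -> dvd (modulus b i) c.
Proof.
  intros Hb Hk.
  enough (H : forall l, l <= k -> exists c, zero < c /\ invertible (modulus b k) c /\
    forall i, i < l -> dvd (modulus b i) c) by apply H, le_refl.
  apply (sigma1_induction (fun l => l <= k -> exists c, zero < c /\
    invertible (modulus b k) c /\ forall i, i < l -> dvd (modulus b i) c)).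
  - unfold invertible, cong. sdefinable.
  - intros _. exists one. repeat split.
    + rewrite <- (add_0_l one). apply lt_0_succ.
    + exists one. rewrite mul_1_l. apply cong_refl.
    + intros i Hi. now apply lt_0_r in Hi.
  - intros l IH Hl. apply le_succ_l in Hl.
    destruct IH as [c [Hc [Hinv Hdvd]]]; [now apply lt_le|].
    exists (c * modulus b l). repeat split.
    + apply mul_pos; auto. apply lt_0_succ.
    + apply invertible_mul; auto. apply invertible_modulus with n; auto.
      * apply le_trans with k; auto using lt_le.
      * intros ->. now apply lt_irrefl in Hl.
    + intros i Hi. apply lt_succ_r in Hi as [Hi| ->].
      * now apply dvd_mul_r, Hdvd.
      * apply dvd_mul_l, dvd_refl.
Qed.

(** * Division with remainder and the entries of a coded sequence *)

Lemma division a m : zero < m -> exists q r, r < m /\ a = q * m + r.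
Proof.
  intros Hm. revert a. apply sigma1_induction.
  - sdefinable.
  - exists zero, zero. split; auto. ring.
  - intros a [q [r [Hr ->]]]. apply le_succ_l in Hr as [Hr|Hr].
    + exists q, (r + one). split; auto. ring.
    + exists (q + one), zero. split; auto. rewrite <- Hr. ring.
Qed.

Lemma division_unique m q r q' r' :
  r < m -> r' < m -> q * m + r = q' * m + r' -> r = r'.
Proof.
  assert (H : forall q r q' r', r < m -> q * m + r = q' * m + r' -> ~ q < q').
  { clear q r q' r'. intros q r q' r' Hr E L. apply lt_exists in L as [k ->].
    assert (E' : r = m + (k * m + r')).
    { apply (add_cancel_l _ _ (q * m)). rewrite E. ring. }
    apply not_lt in Hr; auto. rewrite E'. apply le_add_r. }
  intros Hr Hr' E. destruct (lt_trichotomy q q') as [L|[<-|L]].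
  - exfalso. now apply (H q r q' r').
  - now apply add_cancel_l in E.
  - exfalso. now apply (H q' r' q r).
Qed.

Lemma modulus_pos b i : zero < modulus b i.
Proof. apply lt_0_succ. Qed.

Lemma entry_intro a b i z q :
  z < modulus b i -> a = q * modulus b i + z -> entry a b i z.
Proof.
  intros Hz ->. split; auto. exists q. split; auto. apply lt_succ_r.
  apply le_trans with (q * modulus b i); [|apply le_add_r].
  apply mul_le_l, modulus_pos.
Qed.

Lemma entry_cong a b i z : z < modulus b i -> cong (modulus b i) a z -> entry a b i z.
Proof.
  intros Hz [v [w E]].
  destruct (division a (modulus b i) (modulus_pos b i)) as [q [r [Hr Ea]]].
  replace z with r; [now apply entry_intro with q|].
  apply (division_unique (modulus b i) (q + w) r v z); auto.
  rewrite add_comm, (add_comm z) in E. rewrite (add_comm (v * _)), (add_comm z), <- E, Ea. ring.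
Qed.

Lemma entry_unique a b i z z' : entry a b i z -> entry a b i z' -> z = z'.
Proof.
  intros [Hz [q [_ E]]] [Hz' [q' [_ E']]].
  apply (division_unique (modulus b i) q z q' z'); congruence.
Qed.

Lemma entry_le a b i z : entry a b i z -> z <= a.
Proof. intros [_ [q [_ ->]]]. apply le_add_l. Qed.

Lemma entry_add_mul a b i z c t :
  dvd (modulus b i) c -> entry a b i z -> entry (a + c * t) b i z.
Proof.
  intros [s [_ ->]] [Hz [q [_ E]]]. apply entry_intro with (q + s * t); auto.
  rewrite E at 1. ring.
Qed.

(** Closure under substitution of terms is built in, so that [P] can be used at any place of a
    formula. *)
Definition definable1 (P : N -> Prop) : Prop :=
  forall t, tdef t -> sdef (fun e => P (t e)).

Definition definable2 (R : N -> N -> Prop) : Prop :=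
  forall t u, tdef t -> tdef u -> ddef (fun e => R (t e) (u e)).

(** Chinese remaindering, one entry at a time: a multiple of all earlier moduli leaves the earlier
    entries alone, and being invertible modulo the next modulus it can be scaled to set the next
    entry. The bound [B] lets [b] be fixed in advance. *)
Lemma beta_sequence (R : N -> N -> Prop) n B :
  definable2 R -> (forall i, i < n -> exists z, z <= B /\ R i z) ->
  exists a b, forall i, i < n -> exists z, R i z /\ entry a b i z.
Proof.
  intros HR Htot. destruct (common_multiple_exists n B) as [b [HB Hb]].
  enough (H : forall k, k <= n -> exists a, forall i, i < k ->
    exists z, z < B + one /\ (R i z /\ entry a b i z)).
  { destruct (H n (le_refl n)) as [a Ha]. exists a, b. intros i Hi.
    destruct (Ha i Hi) as [z [_ Hz]]. now exists z. }
  apply (sigma1_induction (fun k => k <= n -> exists a, forall i, i < k ->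
    exists z, z < B + one /\ (R i z /\ entry a b i z))).
  - unfold definable2 in HR. sdefinable.
  - intros _. exists zero. intros i Hi. now apply lt_0_r in Hi.
  - intros k IH Hk. apply le_succ_l in Hk.
    destruct IH as [a Ha]; [now apply lt_le|].
    destruct (moduli_multiple n b k Hb (lt_le _ _ Hk)) as [c [_ [[u Hu] Hc]]].
    destruct (Htot k Hk) as [z [Hz HRz]].
    set (x := (k + one) * b).
    (* Modulo [modulus b k], [c u] is 1 and [x] is -1, so the new number is [a + (z - a)]. *)
    exists (a + c * (u * (z + x * a))). intros i Hi.
    apply lt_succ_r in Hi as [Hi| ->].
    + destruct (Ha i Hi) as [y [HyB [HRy Hy]]]. exists y. auto using entry_add_mul.
    + exists z. split; [now apply lt_succ_r|]. split; auto. apply entry_cong.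
      * apply lt_succ_r. apply le_trans with B; auto. apply le_trans with b; auto.
        rewrite mul_comm. apply mul_le_l, lt_0_succ.
      * apply cong_trans with (a + one * (z + x * a)).
        -- apply cong_add_l. rewrite mul_assoc. now apply cong_mul_r.
        -- replace (a + one * (z + x * a)) with (z + a * modulus b k)
             by (unfold modulus, x; ring).
           apply cong_add_mul.
Qed.

(** The code [c] is the least positive common multiple of the moduli indexed by
    [P]: a further modulus dividing it could be cancelled. *)
Lemma bounded_sigma1_comprehension (P : N -> Prop) n :
  definable1 P -> exists b c, forall i, i < n -> P i <-> dvd (modulus b i) c.
Proof.
  intros HP. destruct (common_multiple_exists n one) as [b [H1 Hb]].
  destruct (moduli_multiple n b n Hb (le_refl n)) as [c0 [Hc0 [_ Hdvd]]].
  unfold definable1 in HP.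
  destruct (pi1_least
    (fun c => zero < c /\ forall i, i < n -> P i -> dvd (modulus b i) c) c0)
    as [c [[Hc Hmul] Hleast]].
  (* The negated property, rewritten so that [P] occurs positively. *)
  - apply (sdef_iff _ (fun e => ~ zero < e 0 \/
      exists i, i < n /\ (~ dvd (modulus b i) (e 0) /\ P i))).
    + intros e. split; [firstorder|]. intros H. apply NNPP; intros Hn.
      apply H. split; [apply NNPP; intros Hz; apply Hn; now left|].
      intros i Hi HPi. apply NNPP; intros Hd. apply Hn. right. now exists i.
    + sdefinable.
  - split; auto.
  - exists b, c. intros j Hj. split; [now apply Hmul|]. intros [q [_ Hq]].
    apply NNPP; intros HPj.
    assert (Hq0 : zero < q).
    { apply lt_0_iff. intros ->. rewrite mul_0_l in Hq.
      rewrite Hq in Hc. now apply lt_irrefl in Hc. }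
    apply (Hleast q).
    (* As [b] is at least 1, the modulus is at least 2, so the quotient [q] lies below [c]. *)
    + rewrite Hq. apply lt_le_trans with (q + q).
      * destruct (zero_or_succ q) as [->|[p ->]]; [now apply lt_irrefl in Hq0|].
        apply lt_exists. exists p. ring.
      * apply le_exists in H1 as [d ->]. unfold modulus.
        apply le_exists. exists (q * (j * (one + d) + d)). ring.
    (* The index [i] satisfies [P] and [j] does not, so the two moduli are distinct and the one at
       [j] cancels. *)
    + split; auto. intros i Hi HPi.
      apply dvd_mul_invertible with (modulus b j).
      * apply invertible_modulus with n; auto using lt_le. now intros ->.
      * rewrite mul_comm, <- Hq. now apply Hmul.
Qed.

(** * The pairing function *)

Lemma le_square x : x <= x * x.
Proof.
  destruct (zero_or_succ x) as [->|[y ->]].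
  - right. ring.
  - apply mul_le_l, lt_0_succ.
Qed.

Definition pairing (x y : N) : N := (x + y) * (x + y) + x.

Lemma pairing_le_l x y : x <= pairing x y.
Proof. apply le_add_l. Qed.

Lemma pairing_le_r x y : y <= pairing x y.
Proof.
  apply le_trans with (x + y); [apply le_add_l|].
  apply le_trans with ((x + y) * (x + y)); [apply le_square|apply le_add_r].
Qed.

(** The code lies between [(x + y)^2] and [(x + y + 1)^2], the latter excluded, so it determines
    [x + y] and then [x]. *)
Lemma pairing_inj x y x' y' : pairing x y = pairing x' y' -> x = x' /\ y = y'.
Proof.
  assert (H : forall x y x' y', pairing x y = pairing x' y' -> ~ x + y < x' + y').
  { clear x y x' y'. unfold pairing. intros x y x' y' E L.
    apply lt_exists in L as [k L]. apply (lt_irrefl ((x + y) * (x + y) + x)).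
    rewrite E at 2. rewrite L. apply lt_exists.
    exists (x + y + y + (x + y + x + y) * k + k * k + k + k + x'). ring. }
  intros E. assert (L : x + y = x' + y').
  { destruct (lt_trichotomy (x + y) (x' + y')) as [L|[L|L]]; auto; exfalso.
    - now apply (H x y x' y').
    - now apply (H x' y' x y). }
  unfold pairing in E. rewrite L in E. apply add_cancel_l in E. subst x'.
  split; auto. now apply add_cancel_l in L.
Qed.

(** * Paths *)

Section Paths.

Variable E : sets M.

Definition adj (x y : N) : Prop :=
  x <= y /\ mem (pairing x y) E \/ y <= x /\ mem (pairing y x) E.

Definition path (s t : N) : Prop :=
  exists a b l, entry a b zero s /\ entry a b l t /\
    forall i, i < l -> exists x, x < a + one /\ exists y, y < a + one /\
      (entry a b i x /\ entry a b (i + one) y /\ adj x y).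

(** Hides the beta codes: a path is given by a Delta^0_0 description of its entries. [R] may leave a
    choice, as adjacency is assumed for all values that it allows. *)
Lemma path_intro (R : N -> N -> Prop) l B s t :
  definable2 R ->
  (forall i, i <= l -> exists z, z <= B /\ R i z) ->
  (forall i x y, i < l -> R i x -> R (i + one) y -> adj x y) ->
  (forall z, R zero z -> z = s) -> (forall z, R l z -> z = t) ->
  path s t.
Proof.
  intros HR Htot Hadj Hs Ht.
  destruct (beta_sequence R (l + one) B HR) as [a [b H]].
  { intros i Hi. now apply Htot, lt_succ_r. }
  exists a, b, l. split; [|split].
  - destruct (H zero (lt_0_succ l)) as [z [Hz He]]. now rewrite <- (Hs z Hz).
  - destruct (H l (lt_succ_diag l)) as [z [Hz He]]. now rewrite <- (Ht z Hz).
  - intros i Hi.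
    destruct (H i) as [x [Hx Ex]]; [now apply lt_succ_r, lt_le|].
    destruct (H (i + one)) as [y [Hy Ey]]; [now apply lt_succ_r, le_succ_l|].
    exists x. split; [now apply lt_succ_r, (entry_le a b i)|].
    exists y. split; [now apply lt_succ_r, (entry_le a b (i + one))|]. eauto.
Qed.

Lemma adj_sym x y : adj x y -> adj y x.
Proof. unfold adj; tauto. Qed.

Lemma path_entry s t a b l :
  entry a b zero s -> entry a b l t ->
  (forall i, i < l -> exists x, x < a + one /\ exists y, y < a + one /\
      (entry a b i x /\ entry a b (i + one) y /\ adj x y)) ->
  forall i, i <= l -> exists z, z <= a /\ entry a b i z.
Proof.
  intros Hs Ht Hadj i [Hi| ->].
  - destruct (Hadj i Hi) as [x [_ [y [_ [Hx _]]]]].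
    exists x. eauto using entry_le.
  - exists t. eauto using entry_le.
Qed.

Lemma path_refl s : path s s.
Proof.
  apply (path_intro (fun _ z => z = s) zero s); auto.
  - unfold definable2. intros. definable.
  - intros. exists s. auto using le_refl.
  - intros i x y Hi. now apply lt_0_r in Hi.
Qed.

Lemma path_sym s t : path s t -> path t s.
Proof.
  intros [a [b [l [Hs [Ht Hadj]]]]].
  pose proof (path_entry s t a b l Hs Ht Hadj) as Hz.
  (* The entry at [l - i] becomes the entry at [i]; the index is expressed without subtraction, and
     [a] bounds all entries. *)
  apply (path_intro (fun i z => exists j, j < l + one /\ (i + j = l /\ entry a b j z)) l a).
  - unfold definable2. intros. definable.
  - intros i Hi. apply le_exists in Hi as [j ->].
    destruct (Hz j (le_add_l _ _)) as [z [Hza Hjz]]. exists z. split; auto.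
    exists j. split; auto. apply lt_succ_r, le_add_l.
  - intros i x y _ [j [_ [Ej Hx]]] [k [Hk [Ek Hy]]].
    assert (j = k + one) as ->.
    { apply (add_cancel_l _ _ i). rewrite Ej, <- Ek. ring. }
    destruct (Hadj k) as [y' [_ [x' [_ [Hy' [Hx' H]]]]]].
    { rewrite <- Ek. apply lt_exists. exists i. ring. }
    apply adj_sym. rewrite (entry_unique _ _ _ _ _ Hx Hx'),
      (entry_unique _ _ _ _ _ Hy Hy'). exact H.
  - intros z [j [_ [Ej Hz']]]. rewrite add_0_l in Ej. subst j.
    now apply (entry_unique a b l).
  - intros z [j [_ [Ej Hz']]].
    assert (j = zero) as ->.
    { apply (add_cancel_l _ _ l). rewrite Ej. ring. }
    now apply (entry_unique a b zero).
Qed.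

Lemma path_trans s t u : path s t -> path t u -> path s u.
Proof.
  intros [a [b [l [Hs [Ht Hadj]]]]] [a' [b' [l' [Ht' [Hu Hadj']]]]].
  pose proof (path_entry s t a b l Hs Ht Hadj) as Hz.
  pose proof (path_entry t u a' b' l' Ht' Hu Hadj') as Hz'.
  (* The two clauses overlap at [i = l], where both describe the common vertex [t]. *)
  apply (path_intro (fun i z => i <= l /\ entry a b i z \/
    exists j, j < l' + one /\ (i = l + j /\ entry a' b' j z)) (l + l') (a + a')).
  - unfold definable2. intros. definable.
  - intros i Hi. destruct (le_or_lt i l) as [L|L].
    + destruct (Hz i L) as [z [Hza Hiz]]. exists z. split; auto.
      apply le_trans with a; auto using le_add_r.
    + apply lt_exists in L as [k ->].
      assert (L : k + one <= l').
      { apply le_exists in Hi as [m Hm]. apply le_exists. exists m.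
        apply (add_cancel_l _ _ l). rewrite Hm. ring. }
      destruct (Hz' (k + one) L) as [z [Hza Hiz]]. exists z. split.
      * apply le_trans with a'; auto using le_add_l.
      * right. exists (k + one). split; [now apply lt_succ_r|]. split; auto. ring.
  - assert (Hleft : forall i x y, i < l -> entry a b i x -> entry a b (i + one) y ->
      adj x y).
    { intros i x y Hi Hx Hy. destruct (Hadj i Hi) as [x' [_ [y' [_ [Hx' [Hy' H]]]]]].
      rewrite (entry_unique _ _ _ _ _ Hx Hx'), (entry_unique _ _ _ _ _ Hy Hy').
      exact H. }
    assert (Hright : forall j x y, j < l' -> entry a' b' j x ->
      entry a' b' (j + one) y -> adj x y).
    { intros i x y Hi Hx Hy. destruct (Hadj' i Hi) as [x' [_ [y' [_ [Hx' [Hy' H]]]]]].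
      rewrite (entry_unique _ _ _ _ _ Hx Hx'), (entry_unique _ _ _ _ _ Hy Hy').
      exact H. }
    (* At the joint the description by the first path is traded for entry 0 of the second, which
       leaves disjoint ranges of indices. *)
    assert (Hmiddle : forall i z, i <= l /\ entry a b i z \/
      (exists j, j < l' + one /\ (i = l + j /\ entry a' b' j z)) ->
      (i < l /\ entry a b i z) \/ exists j, i = l + j /\ entry a' b' j z).
    { intros i z [[[Hi| ->] Hi']|[j [_ Hj]]]; eauto.
      right. exists zero. rewrite (entry_unique _ _ _ _ _ Hi' Ht). split; auto. ring. }
    intros i x y Hi Hx Hy.
    destruct (Hmiddle i x Hx) as [[L Hx']|[j [-> Hx']]].
    + destruct Hy as [[_ Hy]|[k [_ [Ek Hy]]]]; [now apply (Hleft i)|].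
      assert (k = zero) as ->.
      { apply le_succ_l, le_exists in L as [m Em].
        rewrite Em in Ek. symmetry in Ek.
        apply (add_eq_0 k m), (add_cancel_l _ _ (i + one)).
        transitivity (i + one + m + k); [ring|]. rewrite Ek. ring. }
      apply (Hleft i); auto. rewrite Ek, add_0_r.
      now rewrite (entry_unique _ _ _ _ _ Hy Ht').
    + destruct (Hmiddle (l + j + one) y Hy) as [[L _]|[k [Ek Hy']]].
      * exfalso. apply not_lt in L; auto. rewrite <- add_assoc. apply le_add_r.
      * assert (k = j + one) as ->.
        { apply (add_cancel_l _ _ l). rewrite <- Ek. ring. }
        apply (Hright j); auto. now apply (add_lt_cancel_l _ _ l).
  - intros z [[_ Hz0]|[j [_ [Ej Hz0]]]]; [now apply (entry_unique a b zero)|].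
    symmetry in Ej. apply add_eq_0 in Ej as [-> ->].
    rewrite (entry_unique _ _ _ _ _ Hz0 Ht'). now apply (entry_unique a b zero).
  - intros z [[L Hz0]|[j [_ [Ej Hz0]]]].
    + apply le_exists in L as [m Em].
      assert (l' + m = zero) as Em'.
      { apply (add_cancel_l _ _ l). rewrite add_assoc, <- Em. ring. }
      apply add_eq_0 in Em' as [-> _]. rewrite add_0_r in Hz0.
      rewrite (entry_unique _ _ _ _ _ Hz0 Ht). now apply (entry_unique a' b' zero).
    + apply add_cancel_l in Ej. subst j. now apply (entry_unique a' b' l').
Qed.

End Paths.

Ltac ddef_extra ::= progress unfold le, dvd, modulus, entry, pairing, adj.

(** The bounds on the entries in [path] leave only the quantifiers over [a], [b] and [l]
    unbounded. *)
Lemma sdef_path E s t : tdef s -> tdef t -> sdef (fun e => path E (s e) (t e)).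
Proof. intros Hs Ht. unfold path. sdefinable. Qed.

(** * The theorem in a model *)

Section Graph.

Variables (V E V0 : sets M) (n : N).
Hypothesis V0_bounded : forall v, mem v V0 -> v < n.
Hypothesis V0_reaches :
  forall x, mem x V -> mem x V0 \/ exists v, mem v V0 /\ path E x v.

Definition representative (v : N) : Prop :=
  mem v V0 /\ forall u, u < v -> mem u V0 -> ~ path E u v.

Lemma representative_exists x :
  mem x V -> exists v, representative v /\ path E v x.
Proof.
  intros Hx.
  assert (exists v, mem v V0 /\ path E v x) as [v Hv].
  { destruct (V0_reaches x Hx) as [Hx0|[v [Hv Hp]]].
    - exists x. auto using path_refl.
    - exists v. auto using path_sym. }
  destruct (sigma1_least (fun v => mem v V0 /\ path E v x) v) as [u [[Hu Hp] Hl]]; auto.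
  { apply sdef_and; [sdefinable|]. apply sdef_path; definable. }
  exists u. repeat split; auto. intros w Hw Hw0 Hwp.
  apply (Hl w Hw). split; auto. now apply path_trans with u.
Qed.

Lemma representative_unique u v x :
  representative u -> representative v -> path E u x -> path E v x -> u = v.
Proof.
  intros [Hu Hu'] [Hv Hv'] Hux Hvx.
  destruct (lt_trichotomy u v) as [L|[L|L]]; auto; exfalso.
  - apply (Hv' u L Hu). apply path_trans with x; auto using path_sym.
  - apply (Hu' v L Hv). apply path_trans with x; auto using path_sym.
Qed.

(** Being connected to a smaller element of [V0] is Sigma^0_1 and matters only below [n], so numbers
    [b] and [c] can code it. This turns [representative] into a Delta^0_0 condition. *)
Lemma representative_coded :
  exists b c, forall v, representative v <-> mem v V0 /\ ~ dvd (modulus b v) c.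
Proof.
  destruct (bounded_sigma1_comprehension
    (fun v => exists u, u < v /\ (mem u V0 /\ path E u v)) n) as [b [c H]].
  { intros t Ht. apply sdef_exB; auto. apply sdef_and; [sdefinable|].
    apply sdef_path; definable. }
  exists b, c. intros v. split.
  - intros [Hv Hv']. split; auto. rewrite <- H by auto.
    intros [u [L [Hu Hp]]]. now apply (Hv' u).
  - intros [Hv Hd]. rewrite <- H in Hd by auto. split; auto.
    intros u L Hu Hp. apply Hd. now exists u.
Qed.

Lemma decomposition_set :
  exists F, (forall p, mem p F -> exists x v, mem x V /\ p = pairing x v) /\
    forall x v, mem (pairing x v) F <-> mem x V /\ representative v /\ path E v x.
Proof.
  destruct representative_coded as [b [c Hbc]].
  (* With [representative] expressed through [b] and [c], only [path] goes beyond Delta^0_0. *)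
  set (P := fun p => exists x, x < p + one /\ exists v, v < p + one /\
    ((p = pairing x v /\ mem x V /\ mem v V0 /\ ~ dvd (modulus b v) c) /\ path E v x)).
  assert (HP : forall p, P p <->
    exists x v, p = pairing x v /\ mem x V /\ representative v /\ path E v x).
  { intros p. split.
    - intros [x [_ [v [_ [[Ep [Hx Hv]] Hp]]]]]. exists x, v. now rewrite Hbc.
    - intros [x [v [Ep [Hx [Hv Hp]]]]]. apply Hbc in Hv. subst p.
      exists x. split; [apply lt_succ_r, pairing_le_l|].
      exists v. split; [apply lt_succ_r, pairing_le_r|]. tauto. }
  destruct (delta1_comprehension P) as [F HF].
  - unfold P. apply sdef_exB; [definable|]. apply sdef_exB; [definable|].
    apply sdef_and; [sdefinable|]. apply sdef_path; definable.
  (* The complement: a number that does not code a vertex and a representative qualifies vacuously,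
     any other through a competing representative [w]. *)
  - apply (sdef_iff _ (fun e => forall x, x < e 0 + one -> forall v, v < e 0 + one ->
      (e 0 = pairing x v /\ mem x V /\ mem v V0 /\ ~ dvd (modulus b v) c) ->
      exists w, (mem w V0 /\ ~ dvd (modulus b w) c /\ w <> v) /\ path E w x)).
    + intros e. rewrite HP. split.
      * intros H [x [v [Ep [Hx [Hv Hp]]]]].
        destruct (H x) with v as [w [[Hw [Hw' Hwv]] Hwp]].
        -- rewrite Ep. apply lt_succ_r, pairing_le_l.
        -- rewrite Ep. apply lt_succ_r, pairing_le_r.
        -- now rewrite <- Hbc.
        -- apply Hwv, (representative_unique w v x); auto. now apply Hbc.
      * intros H x _ v _ [Ep [Hx Hv]]. rewrite <- Hbc in Hv.
        destruct (representative_exists x Hx) as [w [Hw Hwp]].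
        exists w. split; auto. destruct (proj1 (Hbc w) Hw) as [Hw0 Hwd].
        repeat split; auto. intros ->. apply H. now exists x, v.
    + apply sdef_allB; [definable|]. apply sdef_allB; [definable|].
      apply sdef_imp; [definable|]. apply sdef_ex, sdef_and; [sdefinable|].
      apply sdef_path; definable.
  - exists F. split.
    + intros p Hp. apply HF, HP in Hp as [x [v [Ep [Hx _]]]]. now exists x, v.
    + intros x v. rewrite HF, HP. split.
      * intros [x' [v' [Ep H]]]. apply pairing_inj in Ep as [-> ->]. exact H.
      * intros H. now exists x, v.
Qed.

End Graph.

(** * The formulas about graphs, read in the model *)

Lemma sat_Le (e : env) c s t : sat e c (s ≤ t) <-> eval e s <= eval e t.
Proof. apply sat_Or. Qed.

Lemma sat_Entry (e : env) c a b i z :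
  sat e c (Entry a b i z) <-> entry (eval e a) (eval e b) (eval e i) (eval e z).
Proof.
  unfold Entry, entry. rewrite sat_And, sat_ExB. cbn [sat eval].
  setoid_rewrite eval_lift. reflexivity.
Qed.

Lemma sat_Adj (e : env) c E s t :
  sat e c (Adj E s t) <-> adj (c E) (eval e s) (eval e t).
Proof. unfold Adj. rewrite sat_Or, !sat_And, !sat_Le. reflexivity. Qed.

Lemma sat_Path (e : env) c E s t :
  sat e c (Path E s t) <-> path (c E) (eval e s) (eval e t).
Proof.
  unfold Path, path.
  rewrite sat_ExN. apply ex_iff_morphism; intros a.
  rewrite sat_ExN. apply ex_iff_morphism; intros b.
  rewrite sat_ExN. apply ex_iff_morphism; intros l.
  rewrite !sat_And, !sat_Entry, sat_AllB, !eval_lift.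
  apply and_iff_compat_l, and_iff_compat_l, all_iff_morphism; intros i.
  apply imp_iff_compat_l.
  rewrite sat_ExB. apply ex_iff_morphism; intros x. apply and_iff_compat_l.
  rewrite sat_ExB. apply ex_iff_morphism; intros y. apply and_iff_compat_l.
  now rewrite !sat_And, !sat_Entry, sat_Adj.
Qed.

Lemma sat_SameValue (e : env) c F s t :
  sat e c (SameValue F s t) <-> exists z, mem (pairing (eval e s) z) (c F) /\
                                         mem (pairing (eval e t) z) (c F).
Proof.
  unfold SameValue. rewrite sat_ExN. setoid_rewrite sat_And. cbn [sat eval pair].
  setoid_rewrite eval_lift. reflexivity.
Qed.

Lemma sat_Function (e : env) c V F :
  (forall p, mem p (c F) -> exists x v, mem x (c V) /\ p = pairing x v) ->
  (forall x, mem x (c V) -> exists v, mem (pairing x v) (c F) /\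
     forall u, mem (pairing x u) (c F) -> u = v) ->
  sat e c (Function V F).
Proof.
  intros H1 H2. unfold Function. rewrite sat_And. split.
  - intros p Hp. destruct (H1 p Hp) as [x [v H]].
    rewrite sat_ExN. exists x. rewrite sat_ExN. exists v. rewrite sat_And. exact H.
  - intros x Hx. destruct (H2 x Hx) as [v H].
    rewrite sat_ExN. exists v. rewrite sat_And. exact H.
Qed.

Lemma decomposition_in_model :
  valid M
    (AllS (AllS (AllS (
      Graph 2 1 ⇒
      FiniteSet 0 ⇒
      Subset 0 2 ⇒
      AllN (#0 ∈ 2 ⇒ (#0 ∈ 0 ∨ ExN (#0 ∈ 0 ∧ Path 1 #1 #0))) ⇒
      (ExS (Decomposition 3 2 0) ∧ ExS (Component 3 2 0)))))).
Proof.
  intros e c V E V0 HG HV0 _ Hreach.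
  assert (Hx0 : exists x, mem x V).
  { unfold Graph in HG. rewrite sat_And, sat_ExN in HG. apply HG. }
  assert (Hbound : exists n, forall v, mem v V0 -> v < n).
  { unfold FiniteSet in HV0. rewrite sat_ExN in HV0. exact HV0. }
  assert (Hreach' : forall x, mem x V ->
    mem x V0 \/ exists v, mem v V0 /\ path E x v).
  { intros x Hx. specialize (Hreach x Hx). rewrite sat_Or, sat_ExN in Hreach.
    destruct Hreach as [H|[v H]]; [now left|]. right. exists v.
    rewrite sat_And, sat_Path in H. exact H. }
  clear HG HV0 Hreach. destruct Hbound as [n Hbound].
  destruct (decomposition_set V E V0 n Hbound Hreach') as [F [HF HF']].
  pose proof (representative_exists V E V0 Hreach') as Hex.
  pose proof (representative_unique E V0) as Huniq.
  rewrite sat_And, !sat_ExS. split.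
  - exists F. unfold Decomposition. rewrite sat_And. split.
    + apply sat_Function; [exact HF|]. intros x Hx.
      destruct (Hex x Hx) as [v [Hv Hp]]. exists v. split; [now apply HF'|].
      intros u Hu. apply HF' in Hu as [_ [Hu Hup]]. now apply (Huniq u v x).
    + intros x y Hx Hy _. rewrite sat_Iff, sat_SameValue, sat_Path.
      simpl in Hx, Hy |- *. setoid_rewrite HF'. split.
      * intros [v [[_ [Hv Hvx]] [_ [_ Hvy]]]]. apply path_trans with v; auto using path_sym.
      * intros Hxy. destruct (Hex x Hx) as [v [Hv Hvx]]. exists v.
        repeat split; auto; try apply Hv. now apply path_trans with x.
  - destruct Hx0 as [x0 Hx0]. destruct (Hex x0 Hx0) as [v [Hv Hvx]].
    (* With [F] as a set parameter the fibre over [v] is Delta^0_0. *)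
    destruct (delta1_comprehension (fun x => mem (pairing x v) F)) as [C HC].
    1,2: sdefinable.
    exists C. unfold Component. rewrite !sat_And, sat_ExN. repeat split.
    + exists x0. apply HC, HF'. auto.
    + intros x Hx. apply HC, HF' in Hx. apply Hx.
    + intros x y Hx Hy. apply HC, HF' in Hx, Hy. rewrite sat_Path.
      apply path_trans with v; [apply path_sym, Hx|apply Hy].
    + intros x y Hx Hy Hp. rewrite sat_Path in Hp. apply HC, HF' in Hx.
      apply HC, HF'. split; [exact Hy|]. split; [exact Hv|].
      apply path_trans with x; [apply Hx|exact Hp].
Qed.

End Arithmetic.

(* Set indices: V = 2, E = 1, V_0 = 0; inside [ExS]: V = 3, E = 2 and the
   witness is 0. *)
Theorem theorem3p1 :
  provable RCA0
    (AllS (AllS (AllS (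
      Graph 2 1 ⇒
      FiniteSet 0 ⇒
      Subset 0 2 ⇒
      AllN (#0 ∈ 2 ⇒ (#0 ∈ 0 ∨ ExN (#0 ∈ 0 ∧ Path 1 #1 #0))) ⇒
      (ExS (Decomposition 3 2 0) ∧ ExS (Component 3 2 0)))))).
Proof.
  apply completeness. intros M HM e c.
  (* The given environment supplies [c 0] as the default set. *)
  exact (decomposition_in_model M HM (c 0) e c).
Qed.
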